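(* Let $p>1$, let $\mathcal{G}=\sqcup_{i=1}^k \mathcal{T}_i$ be a forest (disjoint union of the trees $\mathcal{T}_1,\dots,\mathcal{T}_k$), let $\mathcal{H}_p$ be a generalized $p$-Laplacian operator on $\mathcal{G}$, and let $\mathcal{H}_p(\mathcal{T}_i)$ be the restriction of $\mathcal{H}_p$ to the $i$-th tree $\mathcal{T}_i$. Then $\mathcal{H}_p$ admits only variational eigenvalues (every eigenvalue of $\mathcal{H}_p$ is a variational eigenvalue), and for any such eigenvalue $\lambda$ it holds $$\mathrm{mult}_{\mathcal{H}_p}(\lambda)=\gamma\text{-}\mathrm{mult}_{\mathcal{H}_p}(\lambda)=\sum_{i=1}^k \mathrm{mult}_{\mathcal{H}_p(\mathcal{T}_i)}(\lambda),$$ where $\mathrm{mult}_{\mathcal{H}_p(\mathcal{T}_i)}(\lambda)=0$ if $\lambda$ is not an eigenvalue of $\mathcal{H}_p(\mathcal{T}_i)$.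
   Context: Let $\mathcal{G}=(V,E)$ be a finite undirected simple graph (not necessarily connected) with $N=|V|$ nodes, positive node weights $\varrho:V\to\mathbb{R}_+$ and positive symmetric edge weights $\omega:E\to\mathbb{R}_+$; $v\sim u$ means that $uv\in E$. For $p>1$ put $\phi_p(x)=|x|^{p-2}x$ (with $\phi_p(0)=0$). Given real coefficients $\kappa_u$, $u\in V$, the generalized $p$-Laplacian is $(\mathcal{H}_p f)(u)=\sum_{v\sim u}\omega_{uv}\phi_p(f(u)-f(v))+\kappa_u\phi_p(f(u))$ for $f:V\to\mathbb{R}$. A nonzero $f$ is an eigenfunction with eigenvalue $\lambda\in\mathbb{R}$ if $(\mathcal{H}_pf)(u)=\lambda\varrho_u\phi_p(f(u))$ for all $u\in V$. The restriction $\mathcal{H}_p(\mathcal{T}_i)$ is the generalized $p$-Laplacian on $\mathcal{T}_i$ given by the same formula with $\omega,\varrho,\kappa$ restricted to $\mathcal{T}_i$. Krasnoselskii genus: for a closed symmetric set $A=-A$ in $\mathbb{R}^N$, $\gamma(A)$ is the least $k\in\mathbb{N}$ such that there is a continuous odd map $\varphi:A\to\mathbb{R}^k$ with $0\notin\varphi(A)$; $\gamma(A)=\infty$ if no such $k$ exists and $\gamma(\emptyset)=0$. Let $\mathcal{S}_p=\{f:V\to\mathbb{R}:\|f\|_p=1\}$, $\mathcal{F}_k(\mathcal{S}_p)=\{A\subseteq\mathcal{S}_p: A=-A \text{ closed},\ \gamma(A)\ge k\}$, and $$\mathcal{R}_{\mathcal{H}_p}(f)=\frac{\sum_{uv\in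 E}\omega_{uv}|f(u)-f(v)|^p+\sum_{u\in V}\kappa_u|f(u)|^p}{\sum_{u\in V}\varrho_u|f(u)|^p}.$$ The variational eigenvalues are $\lambda_k=\min_{A\in\mathcal{F}_k(\mathcal{S}_p)}\max_{f\in A}\mathcal{R}_{\mathcal{H}_p}(f)$, $k=1,\dots,N$, so $\lambda_1\le\dots\le\lambda_N$. For a variational eigenvalue $\lambda$, $\mathrm{mult}_{\mathcal{H}_p}(\lambda)$ is the number of times $\lambda$ appears in the sequence $\lambda_1,\dots,\lambda_N$. For an eigenvalue $\lambda$, $\gamma\text{-}\mathrm{mult}_{\mathcal{H}_p}(\lambda)=\gamma(\{f\in\mathcal{S}_p:(\mathcal{H}_pf)(u)=\lambda\varrho_u\phi_p(f(u))\ \forall u\in V\})$. The same definitions apply to $\mathcal{H}_p(\mathcal{T}_i)$ on $\mathcal{T}_i$. *)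

(* Defs.v *)
From HB Require Import structures.
From mathcomp Require Import all_boot all_order all_algebra.
From mathcomp Require Import all_classical all_reals all_analysis.

Set Implicit Arguments.
Unset Strict Implicit.
Unset Printing Implicit Defensive.

Import Order.TTheory GRing.Theory Num.Theory.
Import numFieldNormedType.Exports.
(* V -> R carries the product topology: for a finite V, the usual topology of
   R^N with N = #|V|. *)
Import ArrowAsProduct.

Local Open Scope classical_set_scope.
Local Open Scope ring_scope.

(* [edge_weight u v] is only meaningful when [adj u v]. *)
Record wgraph (R : realType) (V : finType) := WGraph {
  adj : rel V;
  edge_weight : V -> V -> R;
  node_weight : V -> R;
  adj_irrefl : irreflexive adj;
  adj_sym : symmetric adj;
  edge_weight_gt0 : forall u v, adj u v -> 0 < edge_weight u v;
  edge_weight_sym : forall u v, adj u v -> edge_weight u v = edge_weight v u;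
  node_weight_gt0 : forall u, 0 < node_weight u
}.

Section Induced.
Variables (R : realType) (V : finType) (G : wgraph R V) (A : {set V}).

Definition restrict_fun (T : Type) (f : V -> T) (u : {v : V | v \in A}) : T :=
  f (val u).

Definition induced_adj : rel {v : V | v \in A} :=
  fun u v => adj G (val u) (val v).

Definition induced_edge_weight (u v : {v : V | v \in A}) : R :=
  edge_weight G (val u) (val v).

Lemma induced_adj_irrefl : irreflexive induced_adj.
Proof. by move=> u; apply: adj_irrefl. Qed.

Lemma induced_adj_sym : symmetric induced_adj.
Proof. by move=> u v; apply: adj_sym. Qed.

Lemma induced_edge_weight_gt0 u v :
  induced_adj u v -> 0 < induced_edge_weight u v.
Proof. exact: edge_weight_gt0. Qed.

Lemma induced_edge_weight_sym u v :
  induced_adj u v -> induced_edge_weight u v = induced_edge_weight v u.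
Proof. exact: edge_weight_sym. Qed.

Lemma induced_node_weight_gt0 u : 0 < restrict_fun (node_weight G) u.
Proof. exact: node_weight_gt0. Qed.

Definition induced_subgraph : wgraph R {v : V | v \in A} :=
  WGraph induced_adj_irrefl induced_adj_sym induced_edge_weight_gt0
    induced_edge_weight_sym induced_node_weight_gt0.

End Induced.

Section Trees.
Variables (R : realType) (V : finType) (G : wgraph R V).

Definition graph_connected := (0 < #|V|)%N /\ forall u v, connect (adj G) u v.

(* The two-element sequence [:: u; v] with [adj G u v] is a [ucycle], hence the
   bound on the size. *)
Definition graph_acyclic :=
  forall c : seq V, (2 < size c)%N -> ~ ucycle (adj G) c.

Definition is_tree := graph_connected /\ graph_acyclic.

End Trees.

(* The vertex sets [T i] partition V and no edge joins two distinct parts, so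
   that G is the disjoint union of the trees that it induces on them. *)
Definition forest_decomposition (R : realType) (V : finType) (G : wgraph R V)
    (k : nat) (T : 'I_k -> {set V}) :=
  [/\ forall v, exists! i, v \in T i,
      forall i u v, adj G u v -> u \in T i -> v \in T i &
      forall i, is_tree (induced_subgraph G (T i))].

Definition phi_p (R : realType) (p x : R) : R := `|x| `^ (p - 2) * x.

Section Genus.
Variables (R : realType) (V : finType).

Definition symmetric_set (A : set (V -> R)) := [set - f | f in A] = A.

(* Least dimension of an odd continuous nonvanishing map, and +oo if there is
   none; it is 0 exactly for the empty set, as 'rV_0 only contains 0. *)
Definition genus (A : set (V -> R)) : \bar R :=
  ereal_inf [set k%:R%:E | k in [set k : nat |
    exists phi : (V -> R) -> 'rV[R]_k,
      [/\ {within A, continuous phi},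
          forall f, A f -> phi (- f) = - phi f &
          forall f, A f -> phi f != 0]]].

Definition p_norm (p : R) (f : V -> R) : R :=
  (\sum_u `|f u| `^ p) `^ p^-1.

Definition p_sphere (p : R) : set (V -> R) := [set f | p_norm p f = 1].

Definition genus_family (p : R) (k : nat) : set (set (V -> R)) :=
  [set A | [/\ A `<=` p_sphere p, symmetric_set A, closed A &
               (k%:R%:E <= genus A)%E]].

End Genus.

Section PLaplacian.
Variables (R : realType) (V : finType).
Variables (G : wgraph R V) (kappa : V -> R) (p : R).

Definition p_laplacian (f : V -> R) (u : V) : R :=
  \sum_(v | adj G u v) edge_weight G u v * phi_p p (f u - f v)
  + kappa u * phi_p p (f u).

Definition eigen_equation (lambda : R) (f : V -> R) :=
  forall u, p_laplacian f u = lambda * node_weight G u * phi_p p (f u).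

Definition is_eigenvalue (lambda : R) :=
  exists f : V -> R, f <> 0 /\ eigen_equation lambda f.

(* Each edge is counted twice in the double sum over ordered pairs. *)
Definition rayleigh (f : V -> R) : R :=
  ((\sum_u \sum_(v | adj G u v) edge_weight G u v * `|f u - f v| `^ p) / 2
   + \sum_u kappa u * `|f u| `^ p)
  / \sum_u node_weight G u * `|f u| `^ p.

(* The infimum and the suprema are attained for 0 < k <= #|V|; the extended
   reals keep the formula meaningful for the other values of k. *)
Definition variational_value (k : nat) : \bar R :=
  ereal_inf [set ereal_sup [set (rayleigh f)%:E | f in A]
            | A in genus_family p k].

Definition is_variational (lambda : R) :=
  exists k : nat, (0 < k <= #|V|)%N /\ variational_value k = lambda%:E.

(* i : 'I_#|V| starts at 0 and stands for the index i.+1. *)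
Definition variational_mult (lambda : R) : nat :=
  #|[pred i : 'I_#|V| | variational_value i.+1 == lambda%:E]|.

Definition genus_mult (lambda : R) : \bar R :=
  genus [set f : V -> R | p_sphere p f /\ eigen_equation lambda f].

End PLaplacian.

(* Main.v *)
Require Import Defs.
From mathcomp Require Import all_boot all_order all_algebra.
From mathcomp Require Import all_classical all_reals all_analysis.
From mathcomp Require Import ring lra zify.

Set Implicit Arguments.
Unset Strict Implicit.
Unset Printing Implicit Defensive.

Import Order.TTheory GRing.Theory Num.Theory.
Import numFieldNormedType.Exports.
Import ArrowAsProduct.

(** The sign of E(f) = numerator - lambda * denominator of the Rayleigh quotient
    governs everything, and on a forest E can be diagonalised as a quadratic form
    can for p = 2, with odd functions in place of linear ones.  Call a property of
    f of odd codimension n when it holds wherever some n odd continuous functions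
    vanish.  An inertia (a, z, b) of E is a triple with a + z + b = N such that
    E >= 0 has odd codimension a, E <= 0 has b, and, away from f = 0, E > 0 has a + z
    and E < 0 has b + z; moreover z odd conditions force an eigenfunction to be 0 and
    a + b odd conditions force f to satisfy the eigenvalue equation.

    Such an inertia determines all multiplicities.  A set of genus k meets the
    zero locus of fewer than k odd functions, by definition of the genus, and the
    zero locus of N - k odd functions on the sphere has genus at least k, by the
    Borsuk-Ulam theorem ([genus_ge_codim]).  With compactness, the variational
    value number k is below, equal to or above lambda according to k <= a,
    a < k <= a + z or a + z < k ([variational_value_eq]), and the set of normalised
    eigenfunctions has genus z ([genus_mult_inertia]).  So both multiplicities are
    z, and lambda is an eigenvalue iff z > 0.

    An acyclic graph has an inertia ([acyclic_inertia]), by removal of a vertex u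
    with at most one neighbour v.  Let c be the potential, c = kappa - lambda rho.
    If u is isolated, c(u)|f(u)|^p contributes its sign.  If u is a leaf and
    c(u) = w phi_p(t) with t <> -1, where w is the weight of uv, then f(u) =
    f(v)/(1+t) is forced on eigenfunctions; moving w phi_p(t/(1+t)) to the
    potential of v leaves a two-point form that is nonnegative if 1+t > 0,
    nonpositive if 1+t < 0, and 0 when that relation holds.  If t = -1, an
    eigenfunction vanishes at v; both u and v are removed, each remaining
    neighbour of v gains the weight of its edge in its potential, and the pair
    contributes one negative and one positive direction by convexity of |x|^p, as
    a hyperbolic plane does for p = 2.

    Inertias of disjoint graphs add up ([forest_inertia]), which gives the sum over
    the trees.

    The Borsuk-Ulam theorem comes from Fan's combinatorial argument on chains
    modulo 2 ([no_fan_labelling]): an odd map without zeros from a sphere to a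
    space of too small a dimension would label the vertices of a fine subdivision
    of the octahedron antipodally, without opposite labels on a simplex, and with
    fewer indices than the count of alternating simplices requires. *)

(** * Chains modulo 2 *)

Section Chains.
Variable E : Type.
Implicit Types (f : seq E -> bool) (s : seq E) (c d : seq (seq E)).

(** Simplices are tuples of points and a chain is the list of its simplices.  Two
    lists denote the same chain modulo 2 when all cochains [f] agree on them, so
    every identity between chains below is stated under [ev f]. *)
Definition ev f c : bool := \big[addb/false]_(s <- c) f s.

Lemma ev_nil f : ev f [::] = false. Proof. by rewrite /ev big_nil. Qed.

Lemma ev_cons f s c : ev f (s :: c) = f s (+) ev f c.
Proof. by rewrite /ev big_cons. Qed.

Lemma ev_cat f c d : ev f (c ++ d) = ev f c (+) ev f d.
Proof. by rewrite /ev big_cat. Qed.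

Lemma eq_ev f g c : f =1 g -> ev f c = ev g c.
Proof. by move=> fg; rewrite /ev; apply: eq_bigr => s _. Qed.

Lemma ev_addb f g c : ev (fun s => f s (+) g s) c = ev f c (+) ev g c.
Proof. by rewrite /ev big_split. Qed.

(** The empty tuple is the only face of a point: the complex is augmented, which
    makes cones behave uniformly in all dimensions. *)
Fixpoint faces s : seq (seq E) :=
  if s is x :: s' then s' :: map (cons x) (faces s') else [::].

Definition boundary c := flatten (map faces c).

End Chains.

Lemma ev_map (E F : Type) (h : seq E -> seq F) f c :
  ev f (map h c) = ev (f \o h) c.
Proof. by rewrite /ev big_map. Qed.

Lemma ev_flatten (E F : Type) (h : seq E -> seq (seq F)) f c :
  ev f (flatten (map h c)) = ev (fun s => ev f (h s)) c.
Proof. by rewrite /ev big_flatten big_map. Qed.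

Lemma faces_map (E F : Type) (h : E -> F) s :
  faces (map h s) = map (map h) (faces s).
Proof.
by elim: s => //= x s ->; congr (_ :: _); rewrite -!map_comp; apply: eq_map.
Qed.

Lemma boundary_cone (E : Type) f (x : E) c :
  ev f (boundary (map (cons x) c)) = ev f c (+) ev (f \o cons x) (boundary c).
Proof.
rewrite /boundary -map_comp !ev_flatten -ev_addb.
by apply: eq_ev => s /=; rewrite ev_cons ev_map.
Qed.

Lemma boundary_faces (E : Type) f (s : seq E) : ev f (boundary (faces s)) = false.
Proof.
elim: s f => [|x s IH] f; first by rewrite /boundary /= ev_nil.
rewrite [faces _]/= /boundary [flatten _]/= ev_cat -/(boundary _) boundary_cone IH.
by rewrite addbF addbb.
Qed.

Lemma boundary_map (E F : Type) (h : E -> F) c :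
  boundary (map (map h) c) = map (map h) (boundary c).
Proof.
elim: c => //= s c; rewrite /boundary /= map_cat => ->.
by rewrite faces_map.
Qed.

(** * Barycentric subdivision *)

Section Subdivision.
Variables (E : eqType) (center : seq E -> E).

(** The subdivision of a simplex is the cone, from its centre, over the
    subdivision of its boundary. *)
Fixpoint subdiv_rec n (s : seq E) : seq (seq E) :=
  if n is n'.+1 then
    map (cons (center s)) (flatten (map (subdiv_rec n') (faces s)))
  else [:: [::]].

Definition subdiv s := subdiv_rec (size s) s.

Definition Subdiv (c : seq (seq E)) := flatten (map subdiv c).

Lemma face_sizeP (s t : seq E) : t \in faces s -> size s = (size t).+1.
Proof.
elim: s t => //= x s IH t; rewrite inE => /predU1P[->//|/mapP[t' /IH -> ->]].
by [].
Qed.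

Lemma face_sub (s t : seq E) : t \in faces s -> {subset t <= s}.
Proof.
elim: s t => //= x s IH t; rewrite inE => /predU1P[->|/mapP[t' /IH st ->]] y.
  by rewrite inE orbC => ->.
by rewrite !inE => /predU1P[->|/st ->]; rewrite ?eqxx ?orbT.
Qed.

Lemma ev_subdiv_faces f n s : size s = n.+1 ->
  ev f (flatten (map (subdiv_rec n) (faces s))) = ev f (Subdiv (faces s)).
Proof.
move=> sn; congr (ev f (flatten _)); apply/eq_in_map => t /face_sizeP.
by rewrite sn /subdiv => -[->].
Qed.

(** The subdivided boundary is itself a cycle by induction, and the boundary of
    the cone over a cycle is that cycle. *)
Lemma boundary_subdiv f s :
  ev f (boundary (subdiv s)) = ev f (Subdiv (faces s)).
Proof.
move: {2}(size s) (erefl (size s)) => n; elim: n f s => [|n IH] f s sn.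
  by rewrite (size0nil sn) /subdiv /= /boundary /Subdiv.
rewrite {1}/subdiv sn /= boundary_cone ev_subdiv_faces //.
rewrite [X in _ (+) X](_ : _ = false) ?addbF //.
set g := f \o _.
have -> : flatten [seq subdiv_rec n i | i <- faces s] = Subdiv (faces s).
  congr flatten; apply/eq_in_map => t /face_sizeP.
  by rewrite sn /subdiv => -[->].
rewrite /boundary ev_flatten /Subdiv ev_flatten.
transitivity (ev (fun t => ev g (Subdiv (faces t))) (faces s)).
  rewrite /ev !big_seq; apply: eq_bigr => t /face_sizeP; rewrite sn => -[nt].
  by rewrite -/(ev _ _) -(ev_flatten (@faces E)) IH.
transitivity (ev (fun t => ev g (subdiv t)) (boundary (faces s))).
  by rewrite /boundary ev_flatten; apply: eq_ev => t; rewrite /Subdiv ev_flatten.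
exact: boundary_faces.
Qed.

Lemma boundary_Subdiv f c : ev f (boundary (Subdiv c)) = ev f (Subdiv (boundary c)).
Proof.
rewrite /boundary /Subdiv ev_flatten ev_flatten ev_flatten ev_flatten.
by apply: eq_ev => s; rewrite -ev_flatten -/(boundary _) boundary_subdiv /Subdiv ev_flatten.
Qed.

Lemma subdiv_size s t : t \in subdiv s -> size t = size s.
Proof.
rewrite /subdiv; move En: (size s) => n.
elim: n s t En => [|n IH] s t sn /=; first by rewrite inE => /eqP ->.
move=> /mapP[u /flatten_mapP[v vs uv] ->] /=; congr _.+1.
by apply: (IH v) => //; have := face_sizeP vs; rewrite sn => -[].
Qed.

(** Used to keep the points of a subdivision in the face of the octahedron that
    they subdivide, and in balls that contain the simplex. *)
Lemma subdiv_closed (P : E -> Prop) :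
  (forall s, s != [::] -> (forall x, x \in s -> P x) -> P (center s)) ->
  forall s t, t \in subdiv s -> (forall x, x \in s -> P x) ->
  forall x, x \in t -> P x.
Proof.
move=> Pc s t; rewrite /subdiv; move En: (size s) => n.
elim: n s t En => [|n IH] s t sn /=; first by rewrite inE => /eqP -> _ x.
move=> /mapP[u /flatten_mapP[v vs uv] ->] sP x; rewrite inE => /predU1P[->|].
  by apply: Pc => //; rewrite -size_eq0 sn.
move=> xu; apply: (IH v u) => //; first by have := face_sizeP vs; rewrite sn => -[].
by move=> y /(face_sub vs)/sP.
Qed.

End Subdivision.

Lemma subdiv_map (E : eqType) (center : seq E -> E) (h : E -> E) :
  (forall s, center (map h s) = h (center s)) ->
  forall s, subdiv center (map h s) = map (map h) (subdiv center s).
Proof.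
move=> ch s; rewrite /subdiv size_map; move: (size s) => n.
elim: n s => //= n IH s; rewrite ch faces_map -!map_comp.
rewrite map_flatten -!map_comp map_flatten -!map_comp; congr flatten.
apply: eq_map => t /=; rewrite IH -!map_comp.
by apply: eq_map => u /=.
Qed.

(** * Fan's alternating labels *)

Fixpoint alternating b (s : seq bool) :=
  if s is x :: s' then (x == b) && alternating (~~ b) s' else true.

(** If a sequence does not alternate, the deletions that make it alternate are
    those of the two entries of a repeated pair, which cancel.  If it does, only
    deletions at the ends keep it alternating: at the back the first sign stays,
    at the front it changes. *)
Lemma alternating_faces b s :
  ev (alternating b) (faces s) = alternating b s (+) alternating (~~ b) s.
Proof.
elim: s b => [|x s IH] b; first by rewrite ev_nil.
rewrite /= ev_cons ev_map.
have -> : ev (alternating b \o cons x) (faces s) =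
    (x == b) && ev (alternating (~~ b)) (faces s).
  rewrite /ev; elim: (faces s) => [|t c IHc]; first by rewrite !big_nil andbF.
  by rewrite !big_cons IHc /= andb_addr.
rewrite IH negbK; case: x; case: b; rewrite /= ?addbF //.
  by rewrite addbC addbK.
by rewrite addbC addbK.
Qed.

(** The label [2 * i + s] stands for the index [i] with sign [s]. *)
Definition antipode l := if odd l then l.-1 else l.+1.

Lemma odd_antipode l : odd (antipode l) = ~~ odd l.
Proof. rewrite /antipode; case: ifP => [ol|/= ->//]; by case: l ol => //= l /negbTE. Qed.

Lemma half_antipode l : (antipode l)./2 = l./2.
Proof.
rewrite /antipode; case: ifP => [|/negbT ol].
  by case: l => //= l /negbTE; rewrite uphalf_half => ->.
by rewrite /= uphalf_half (negbTE ol).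
Qed.

Definition no_complementary (l : seq nat) :=
  {in l &, forall x y, x./2 = y./2 -> x = y}.

(** Sorting merges the indices in increasing order; when no two labels are
    opposite, repeated indices carry equal signs and so break the alternation. *)
Definition fan b (l : seq nat) := alternating b (map odd (sort leq l)).

Lemma fan_perm b l l' : perm_eq l l' -> fan b l = fan b l'.
Proof.
move=> ll'; rewrite /fan; congr (alternating b (map odd _)).
by apply/perm_sortP => //; [exact: leq_total|exact: leq_trans|exact: anti_leq].
Qed.

Lemma ev_faces_rem (F : seq nat -> bool) (l : seq nat) :
  (forall s t, perm_eq s t -> F s = F t) ->
  ev F (faces l) = \big[addb/false]_(x <- l) F (rem x l).
Proof.
move=> FP; elim: l F FP => [|x l IH] F FP; first by rewrite ev_nil big_nil.
rewrite /= ev_cons ev_map big_cons eqxx; congr (_ (+) _).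
rewrite IH; last by move=> s t st; apply: FP; rewrite perm_cons.
rewrite !big_seq; apply: eq_bigr => y yl /=; case: eqP => // xy.
by apply: FP; rewrite perm_sym xy perm_to_rem.
Qed.

Lemma ev_faces_perm (F : seq nat -> bool) (l l' : seq nat) :
  (forall s t, perm_eq s t -> F s = F t) -> perm_eq l l' ->
  ev F (faces l) = ev F (faces l').
Proof.
move=> FP ll'; rewrite !ev_faces_rem // -(perm_big _ ll') /= !big_seq.
apply: eq_bigr => x xl; apply: FP; rewrite -(perm_cons x).
rewrite -(permPl (perm_to_rem xl)) (permPl ll') perm_to_rem //.
by rewrite -(perm_mem ll').
Qed.

Lemma face_subseq (T : eqType) (s t : seq T) : t \in faces s -> subseq t s.
Proof.
elim: s t => //= x s IH t; rewrite inE => /predU1P[->|/mapP[u /IH us ->]].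
  exact: subseq_cons.
by rewrite /= eqxx.
Qed.

(** Fan's relation: the coboundary of one alternation cochain is the next one
    plus its antipodal image. *)
Lemma fan_faces b l : no_complementary l ->
  ev (fan b) (faces l) = fan b l (+) fan b (map antipode l).
Proof.
move=> ncl; set s := sort leq l.
have ps : perm_eq l s by rewrite perm_sym perm_sort.
have ss : sorted leq s by exact/sort_sorted/leq_total.
have -> : fan b (map antipode l) = alternating (~~ b) (map odd s).
  have -> : fan b (map antipode l) = alternating b (map odd (map antipode s)).
    rewrite (@fan_perm _ _ (map antipode s)) ?perm_map// /fan; congr (alternating b (map odd _)).
    apply: sorted_sort; first exact: leq_trans.
    have : {in s &, {homo antipode : x y / x <= y}}.
      move=> x y; rewrite !mem_sort => xl yl xy.
      have [h|h] := eqVneq x./2 y./2; first by rewrite (ncl x y).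
      have {}h : x./2 < y./2 by rewrite ltn_neqAle h half_leq.
      rewrite -[antipode x]odd_double_half -[antipode y]odd_double_half !half_antipode.
      case: (odd _); case: (odd _); rewrite ?leq_add2l ?leq_double ?(ltnW h) //.
        by rewrite /= add1n ltn_double.
      by apply: leqW; rewrite leq_double ltnW.
    by move=> hm; rewrite (homo_sorted_in hm)//; apply/allP.
  rewrite -map_comp; elim: (s) b => //= x t IH b'; rewrite IH odd_antipode.
  by case: (odd x); case: b'.
rewrite (ev_faces_perm _ ps); last exact: fan_perm.
rewrite -alternating_faces faces_map ev_map /ev !big_seq; apply: eq_bigr => t ts.
rewrite /fan /= sorted_sort //; first exact: leq_trans.
by rewrite (subseq_sorted leq_trans (face_subseq ts)).
Qed.

(** An alternating simplex has distinct indices. *)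
Lemma fan_size b n l : no_complementary l -> {in l, forall x, x./2 < n} ->
  fan b l -> size l <= n.
Proof.
move=> ncl ln; rewrite /fan -(size_sort leq).
have ncs : no_complementary (sort leq l) by move=> x y; rewrite !mem_sort; exact: ncl.
have {}ln : {in sort leq l, forall x, x./2 < n} by move=> x; rewrite mem_sort; exact: ln.
move: (sort_sorted leq_total l) ncs ln; move: (sort leq l) => {ncl}{}l sl ncl ln alt.
have : sorted ltn (map half l).
  elim: l b sl ncl alt {ln} => [|x [|y l] IH] b //= /andP[xy yl] ncl /and3P[/eqP xb /eqP yb alt].
  apply/andP; split; last first.
    apply: (IH (~~ b)) => //=; last by rewrite yb eqxx.
    by move=> u v ul vl; apply: ncl; rewrite in_cons ?ul ?vl orbT.
  rewrite ltn_neqAle half_leq // andbT; apply/eqP => h.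
  have := ncl x y; rewrite !inE !eqxx orbT => /(_ isT isT h) exy.
  by move: yb; rewrite -exy xb; case: (b).
rewrite ltn_sorted_uniq_leq => /andP[ul _].
rewrite -(size_map half) -(size_iota 0 n); apply: uniq_leq_size => // z /mapP[x xl ->].
by rewrite mem_iota ln.
Qed.

Local Open Scope classical_set_scope.
Local Open Scope ring_scope.

(** * The Borsuk-Ulam theorem *)

Section Hemispheres.
Variables (E : eqType) (T : E -> E).

(** The k-th chain is a hemisphere of a k-sphere: its boundary is the equator,
    made of two antipodal hemispheres of one dimension less. *)
Definition hemisphere_chain (h : nat -> seq (seq E)) :=
  [/\ exists x, h 0 = [:: [:: x]],
      forall k s, s \in h k -> size s = k.+1 &
      forall k f, ev f (boundary (h k.+1)) = ev f (h k ++ map (map T) (h k))].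

(** By Fan's relation, the number modulo 2 of alternating simplices in the sphere
    made of the two k-dimensional hemispheres does not depend on k.  It is 1 for
    k = 0, where the sphere is a pair of antipodal points, and 0 for k = n, where
    there are too few indices for an alternating simplex. *)
Lemma no_fan_labelling (h : nat -> seq (seq E)) n (label : E -> nat) :
  hemisphere_chain h ->
  (forall k s, (k <= n)%N -> s \in h k -> no_complementary (map label s)) ->
  (forall k s x, (k <= n)%N -> s \in h k -> x \in s ->
     (label x)./2 < n /\ label (T x) = antipode (label x))%N ->
  False.
Proof.
move=> [[x0 h0] hsize hb] ncl hl.
pose a s := fan true (map label s).
pose b k := ev a (h k) (+) ev a (map (map T) (h k)).
have mapT k s : (k <= n)%N -> s \in h k ->
    map label (map T s) = map antipode (map label s).
  move=> kn sh; rewrite -!map_comp; apply/eq_in_map => x xs /=.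
  by have [] := hl _ _ _ kn sh xs.
have bE k : (k <= n)%N -> b k = ev (fun s => a s (+) fan true (map antipode (map label s))) (h k).
  move=> kn; rewrite /b ev_addb; congr (_ (+) _); rewrite ev_map /ev !big_seq.
  by apply: eq_bigr => s sh; rewrite /a /= (mapT k).
have bS k : (k < n)%N -> b k = b k.+1.
  move=> kn; rewrite (bE k.+1) // /b -ev_cat -hb /boundary ev_flatten /ev !big_seq.
  apply: eq_bigr => s sh; rewrite -fan_faces; last exact: ncl sh.
  by rewrite faces_map ev_map.
have b0 : b 0%N.
  rewrite bE // h0 ev_cons ev_nil addbF /a /fan /= odd_antipode.
  by rewrite !eqb_id !andbT addbN addbb.
have bn : b n.
  have: (n <= n)%N by []; elim: {1 3}n => [//|k IH kn].
  by rewrite -bS //; apply: IH; exact: ltnW.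
move: bn; rewrite bE // /ev big_seq big1 // => s sh.
have sz := hsize _ _ sh.
have nc := ncl _ _ (leqnn n) sh.
suff F c l : no_complementary l -> size l = n.+1 -> {in l, forall x, x./2 < n}%N ->
    fan c l = false.
  have ln : {in map label s, forall x, x./2 < n}%N.
    by move=> x /mapP[y ys ->]; have [] := hl _ _ _ (leqnn n) sh ys.
  rewrite /a !F ?size_map //.
  - by move=> x y /mapP[u ul ->] /mapP[v vl ->]; rewrite !half_antipode => /nc ->.
  - by move=> x /mapP[u /ln ul ->]; rewrite half_antipode.
move=> ncl' sl ln; apply/negP => /(fan_size ncl' ln).
by rewrite sl ltnn.
Qed.

Lemma hemisphere_subdiv (center : seq E -> E) h :
  (forall x, center [:: x] = x) ->
  (forall s, center (map T s) = T (center s)) ->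
  hemisphere_chain h -> hemisphere_chain (fun k => Subdiv center (h k)).
Proof.
move=> c1 cT [[x0 h0] hsize hb]; split.
- by exists x0; rewrite h0 /Subdiv /= /subdiv /= c1.
- by move=> k t /flatten_mapP[s sh /subdiv_size ->]; exact: hsize.
- move=> k f; rewrite boundary_Subdiv /Subdiv ev_flatten hb.
  rewrite !ev_cat !ev_flatten !ev_map; congr (_ (+) _).
  by rewrite ev_flatten; apply: eq_ev => s /=; rewrite subdiv_map // ev_map.
Qed.

(** One hemisphere of the octahedron with vertices [e i] and their antipodes. *)
Fixpoint orthant_chain (e : nat -> E) k : seq (seq E) :=
  if k is k'.+1 then
    let c := orthant_chain e k' in map (cons (e k)) (c ++ map (map T) c)
  else [:: [:: e 0]].

Lemma orthant_hemisphere e : involutive T -> hemisphere_chain (orthant_chain e).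
Proof.
move=> TT; set h := orthant_chain e.
have hb k f : ev f (boundary (h k.+1)) = ev f (h k ++ map (map T) (h k)) (+)
    ev (f \o cons (e k.+1)) (boundary (h k ++ map (map T) (h k))).
  by rewrite /h /= boundary_cone.
have bcat (c d : seq (seq E)) : boundary (c ++ d) = boundary c ++ boundary d.
  by rewrite /boundary map_cat flatten_cat.
split; first by exists (e 0).
- elim=> [|k IH] s /=; first by rewrite inE => /eqP ->.
  move=> /mapP[t + ->]; rewrite mem_cat => /orP[/IH /= ->//|/mapP[u /IH + ->]] /=.
  by rewrite size_map => ->.
- elim=> [|k IH] f; rewrite hb [X in _ (+) X](_ : _ = false) ?addbF //.
    by rewrite /boundary /= !ev_cons ev_nil addbF addbb.
  rewrite bcat ev_cat boundary_map ev_map !IH !ev_cat !ev_map.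
  rewrite [X in _ (+) (_ (+) X)](_ : _ = ev (f \o cons (e k.+2)) (h k)).
    by rewrite [X in _ (+) X]addbC addbb.
  by apply: eq_ev => s /=; rewrite mapK.
Qed.

End Hemispheres.

Section Barycentres.
Variables (R : realType) (N : nat).
Local Notation E := 'rV[R]_N.

Definition barycenter (s : seq E) : E := (size s)%:R^-1 *: \sum_(x <- s) x.

Definition mesh_le (d : R) (s : seq E) := {in s &, forall x y, `|x - y| <= d}.

Lemma barycenter1 x : barycenter [:: x] = x.
Proof. by rewrite /barycenter big_seq1 invr1 scale1r. Qed.

Lemma barycenterN s : barycenter (map -%R s) = - barycenter s.
Proof. by rewrite /barycenter size_map big_map sumrN scalerN. Qed.

Lemma barycenterB s v : s != [::] ->
  barycenter s - v = (size s)%:R^-1 *: \sum_(x <- s) (x - v).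
Proof.
move=> s0; rewrite sumrB scalerBr; congr (_ - _).
rewrite big_const_seq count_predT iter_addr_0 -[v *+ _]scaler_nat scalerA mulVf ?scale1r //.
by rewrite pnatr_eq0 size_eq0.
Qed.

Lemma barycenter_ball s b r : s != [::] ->
  (forall x, x \in s -> `|b - x| <= r) -> `|b - barycenter s| <= r.
Proof.
move=> s0 sr; rewrite distrC barycenterB // normrZ ger0_norm ?invr_ge0 ?ler0n //.
rewrite ler_pdivrMl ?ltr0n ?lt0n ?size_eq0 //.
apply: (le_trans (ler_norm_sum _ _ _)).
have -> : (size s)%:R * r = \sum_(x <- s) r.
  by rewrite big_const_seq count_predT iter_addr_0 mulr_natl.
by rewrite !big_seq; apply: ler_sum => x xs; rewrite distrC sr.
Qed.

Lemma barycenter_mesh s n d v : mesh_le d s -> size s = n.+1 -> v \in s ->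
  `|barycenter s - v| <= n%:R / n.+1%:R * d.
Proof.
move=> sd sn vs.
rewrite barycenterB; last by rewrite -size_eq0 sn.
rewrite sn normrZ ger0_norm ?invr_ge0 ?ler0n // mulrC mulrAC.
rewrite ler_wpM2r ?invr_ge0 ?ler0n //.
apply: (le_trans (ler_norm_sum _ _ _)).
rewrite (big_rem v) //= subrr normr0 add0r.
have -> : n%:R * d = \sum_(x <- rem v s) d.
  by rewrite big_const_seq count_predT iter_addr_0 mulr_natl size_rem // sn.
by rewrite !big_seq; apply: ler_sum => x /mem_rem xs; rewrite sd.
Qed.

Definition mesh_ratio : R := N%:R / N.+1%:R.

Lemma mesh_ratio_ge0 : 0 <= mesh_ratio. Proof. by rewrite divr_ge0 ?ler0n. Qed.

Lemma mesh_ratio_lt1 : mesh_ratio < 1.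
Proof. by rewrite ltr_pdivrMr ?ltr0n // mul1r ltr_nat. Qed.

(** A point of a simplex is within the factor [n / (n + 1)] of its diameter from
    the barycentre. *)
Lemma subdiv_mesh s t d : (size s <= N.+1)%N -> 0 <= d -> mesh_le d s ->
  t \in subdiv barycenter s -> mesh_le (mesh_ratio * d) t.
Proof.
move=> sN d0 sd; rewrite /subdiv; move En: (size s) => n.
elim: n s t sN sd En => [|n IH] s t sN sd sn /=.
  by rewrite inE => /eqP -> x.
move=> /mapP[u /flatten_mapP[v vs uv] ->].
have sv : size v = n by have := face_sizeP vs; rewrite sn => -[].
have nr : n%:R / n.+1%:R <= mesh_ratio.
  rewrite /mesh_ratio ler_pdivrMr ?ltr0n // mulrAC ler_pdivlMr ?ltr0n // -!natrM ler_nat.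
  by rewrite !mulnS addnC [in leqRHS]addnC mulnC leq_add2l -ltnS -sn.
have bu x : x \in u -> `|barycenter s - x| <= mesh_ratio * d.
  move=> xu; apply: (@subdiv_closed _ barycenter
    (fun z => `|barycenter s - z| <= mesh_ratio * d) _ v u) xu.
  - by move=> w w0; exact: barycenter_ball.
  - by rewrite /subdiv sv.
  - move=> z /(face_sub vs) zs; apply: (le_trans (barycenter_mesh sd sn zs)).
    by rewrite ler_wpM2r.
have mu : mesh_le (mesh_ratio * d) u.
  apply: (IH v) => //; first by rewrite sv -ltnS -sn ltnW // ltnS.
  by move=> x y /(face_sub vs) + /(face_sub vs); exact: sd.
have rd : 0 <= mesh_ratio * d by rewrite mulr_ge0 ?mesh_ratio_ge0.
move=> x y; rewrite !inE => /predU1P[->|xu] /predU1P[->|yu].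
- by rewrite subrr normr0.
- exact: bu.
- by rewrite distrC bu.
- exact: mu.
Qed.

End Barycentres.

Lemma cvg_finsum (R : realType) (T : Type) (F : set_system T) {FF : Filter F}
    (I : Type) (r : seq I) (P : pred I) (f : I -> T -> R) (a : I -> R) :
  (forall i, P i -> f i x @[x --> F] --> a i) ->
  \sum_(i <- r | P i) f i x @[x --> F] --> \sum_(i <- r | P i) a i.
Proof.
move=> fa; elim: r => [|i r IH].
  by under eq_cvg do rewrite big_nil; rewrite big_nil; exact: cvg_cst.
under eq_cvg do rewrite big_cons; rewrite big_cons.
by case: ifP => // Pi; apply: cvgD => //; exact: fa.
Qed.

Section BorsukUlam.
Variables (R : realType) (N : nat).
Local Notation E := 'rV[R]_N.

Definition unit_row (k : nat) : E := \row_j ((j : nat) == k)%:R.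

(** A flat sphere is used, because its faces are convex and so contain the
    points of their subdivisions. *)
Definition octahedron : set E := [set x : E | \sum_j `|x 0 j| = 1].

Definition orthant (sg : nat -> bool) : set E :=
  [set x : E | (forall j : 'I_N, 0 <= (-1) ^+ sg j * x 0 j) /\
    \sum_(j < N) (-1) ^+ sg j * x 0 j = 1].

Lemma orthant_octahedron sg x : orthant sg x -> octahedron x.
Proof.
move=> [x0 x1]; rewrite /octahedron /= -x1; apply: eq_bigr => j _.
by rewrite -[RHS]ger0_norm ?x0 // normrMsign.
Qed.

Lemma octahedron_neq0 x : octahedron x -> x != 0.
Proof.
apply: contraPneq => ->; rewrite /octahedron /= big1; first by move=> /esym/eqP; rewrite oner_eq0.
by move=> j _; rewrite mxE normr0.
Qed.

Lemma orthant_barycenter sg s : s != [::] ->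
  (forall x, x \in s -> orthant sg x) -> orthant sg (barycenter s).
Proof.
move=> s0 sP; have n0 : (size s)%:R != 0 :> R by rewrite pnatr_eq0 size_eq0.
have bE j : barycenter s 0 j = (size s)%:R^-1 * \sum_(x <- s) x 0 j.
  by rewrite mxE summxE.
split=> [j|].
  rewrite bE mulrCA mulr_sumr mulr_ge0 ?invr_ge0 ?ler0n //.
  by rewrite big_seq; apply: sumr_ge0 => x /sP[].
under eq_bigr do rewrite bE mulrCA mulr_sumr.
rewrite -mulr_sumr exchange_big /= (_ : \sum_(_ <- _) _ = (size s)%:R) ?mulVf //.
rewrite big_seq (eq_bigr (fun=> 1)); last by move=> x /sP[].
by rewrite -big_seq big_const_seq count_predT iter_addr_0.
Qed.

Lemma octahedron_norm x : octahedron x -> `|x| <= 1.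
Proof.
move=> Kx; rewrite [leLHS]/Num.norm /= mx_normrE; apply: bigmax_le => // -[i j] _ /=.
rewrite (ord1 i) -Kx (bigD1 j) //= lerDl; exact: sumr_ge0.
Qed.

Lemma octahedron_compact : compact octahedron.
Proof.
apply: bounded_closed_compact.
  exists 1; split; first exact: num_real.
  by move=> M M1 x /octahedron_norm x1; exact: le_trans x1 (ltW M1).
have -> : octahedron = (fun x : E => \sum_j `|x 0 j|) @^-1` [set 1] by [].
have cN : continuous (fun x : E => \sum_j `|x 0 j|).
  move=> x; apply: (@cvg_finsum _ _ (nbhs x)) => j _.
  by apply: cvg_norm; exact: coord_continuous.
by apply: closed_comp; [move=> x _; exact: cN|exact: closed_eq].
Qed.

Lemma orthant_unit sg j : (j < N)%N -> orthant sg ((-1) ^+ sg j *: unit_row j).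
Proof.
move=> jN.
have eE (i : 'I_N) : (-1) ^+ sg i * ((-1) ^+ sg j *: unit_row j) 0 i = ((i : nat) == j)%:R :> R.
  rewrite !mxE; case: eqP => [->|]; last by rewrite !mulr0.
  by rewrite mulr1 -signr_addb addbb.
split=> [i|]; first by rewrite eE ler0n.
rewrite (eq_bigr _ (fun i _ => eE i)) (bigD1 (Ordinal jN)) //= eqxx big1 ?addr0 //.
by move=> i; rewrite -val_eqE /= => /negbTE ->.
Qed.

Lemma orthant_chain_orthant k s : (k < N)%N ->
  s \in orthant_chain -%R unit_row k -> exists sg, forall x, x \in s -> orthant sg x.
Proof.
move=> kN sk.
suff [sg sgs] : exists sg : nat -> bool, forall x, x \in s ->
    exists2 j, (j <= k)%N & x = (-1) ^+ sg j *: unit_row j.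
  exists sg => x /sgs[j jk ->]; apply: orthant_unit; exact: leq_ltn_trans jk kN.
elim: k s {kN} sk => [|k IH] s /=.
  rewrite inE => /eqP ->; exists (fun=> false) => x; rewrite inE => /eqP ->.
  by exists 0%N; rewrite ?expr0 ?scale1r.
have ext (t : seq E) (sg : nat -> bool) :
    (forall x, x \in t -> exists2 j, (j <= k)%N & x = (-1) ^+ sg j *: unit_row j) ->
    exists sg : nat -> bool, forall x, x \in unit_row k.+1 :: t ->
    exists2 j, (j <= k.+1)%N & x = (-1) ^+ sg j *: unit_row j.
  move=> st; exists (fun j => (j <= k)%N && sg j) => x; rewrite inE => /predU1P[->|/st[j jk ->]].
    by exists k.+1; rewrite ?ltnn ?expr0 ?scale1r.
  by exists j; [exact: leqW|rewrite jk].
move=> /mapP[t + ->]; rewrite mem_cat => /orP[/IH[sg]|/mapP[u /IH[sg us] ->]].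
  exact: ext.
apply: (ext _ (fun j => ~~ sg j)) => x /mapP[y /us[j jk ->] ->]; exists j => //.
by rewrite signrN scaleNr.
Qed.

Definition subdivided_chain m k :=
  iter m (Subdiv (@barycenter R N)) (orthant_chain -%R unit_row k).

Lemma subdivided_hemisphere m : hemisphere_chain -%R (subdivided_chain m).
Proof.
elim: m => [|m IH]; first exact: orthant_hemisphere (@opprK _).
exact: hemisphere_subdiv (@barycenter1 _ _) (@barycenterN _ _) IH.
Qed.

Lemma subdivided_fine m k s : (k < N)%N -> s \in subdivided_chain m k ->
  (exists sg, forall x, x \in s -> orthant sg x) /\
  mesh_le (mesh_ratio R N ^+ m * 2) s.
Proof.
move=> kN; elim: m s => [|m IH] s.
  move=> /(orthant_chain_orthant kN)[sg sgs]; split; first by exists sg.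
  move=> x y /sgs/orthant_octahedron/octahedron_norm x1 /sgs/orthant_octahedron/octahedron_norm y1.
  by rewrite expr0 mul1r (le_trans (ler_normB _ _))// -[2]/(1 + 1) lerD.
rewrite /subdivided_chain iterS => /flatten_mapP[t tm st].
have [[sg tsg] tmesh] := IH _ tm; split.
  exists sg; apply: (subdiv_closed _ st tsg) => u; exact: orthant_barycenter.
rewrite exprS -mulrA; apply: (subdiv_mesh _ _ tmesh st).
  have [_ + _] := subdivided_hemisphere m.
  by move=> /(_ _ _ tm) ->; rewrite ltnW.
by rewrite mulr_ge0 ?exprn_ge0 ?mesh_ratio_ge0.
Qed.

(** Continuity away from the origin is what a function composed with a radial
    projection satisfies. *)
Lemma octahedron_unif_continuous (g : E -> R) (d : R) : 0 < d ->
  (forall x, x != 0 -> {for x, continuous g}) ->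
  exists2 e, 0 < e & forall x y, octahedron x -> octahedron y ->
    `|x - y| < e -> `|g x - g y| < d.
Proof.
move=> d0 gc.
have := octahedron_compact; rewrite compact_near_coveringP => /(_ R (0^'+)
  (fun e x => forall y, octahedron y -> `|x - y| < e -> `|g x - g y| < d)).
case=> [x Kx|].
  have /cvgrPdist_lt /(_ (d / 2)) gx := gc x (octahedron_neq0 Kx).
  have d2 : 0 < d / 2 by rewrite divr_gt0.
  have /nbhs_ballP[r /= r0 rx] := gx d2.
  exists (ball x (r / 2), [set e | e < r / 2]) => /=.
    split; first by apply: nbhsx_ballx; rewrite divr_gt0.
    by apply: nbhs_right_lt; rewrite divr_gt0.
  move=> [z e] [/= xz er] y Ky zy.
  have gz : `|g x - g z| < d / 2.
    apply: rx; move: xz; rewrite -!ball_normE /= => /lt_le_trans; apply.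
    by rewrite ler_pdivrMr // mulr_natr mulr2n lerDl ltW.
  have gy : `|g x - g y| < d / 2.
    apply: rx; move: xz; rewrite -!ball_normE /= => xz.
    rewrite (_ : x - y = (x - z) + (z - y)); last by rewrite addrA subrK.
    rewrite (le_lt_trans (ler_normD _ _))// (splitr r) ltrD // (lt_trans zy) //.
  rewrite (_ : g z - g y = (g x - g y) - (g x - g z)); last by ring.
  rewrite (le_lt_trans (ler_normB _ _))// (splitr d) ltrD //.
move=> e /= e0 He; exists (e / 2); first by rewrite divr_gt0.
move=> x y Kx Ky xy; apply: (He (e / 2)) => //=.
  by rewrite sub0r normrN gtr0_norm ?divr_gt0 // ltr_pdivrMr // mulr_natr mulr2n ltrDl.
by rewrite divr_gt0.
Qed.

(** Without a common zero, at each point of the octahedron some [g i] has modulus at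
    least a fixed [d > 0].  The first such index, with the sign of [g i], is a label, and
    points with opposite labels are far apart by uniform continuity, which
    contradicts [no_fan_labelling] for a fine subdivision. *)
Theorem borsuk_ulam n (g : nat -> E -> R) : (n < N)%N ->
  (forall i x, x != 0 -> {for x, continuous (g i)}) ->
  (forall i x, g i (- x) = - g i x) ->
  exists x, octahedron x /\ forall i, (i < n)%N -> g i x = 0.
Proof.
move=> nN gc godd; apply: contrapT => nozero.
have e0 : octahedron (unit_row 0).
  have := orthant_unit (fun=> false) (leq_ltn_trans (leq0n n) nN).
  by rewrite scale1r => /orthant_octahedron.
pose G x := \sum_(i < n) `|g i x|.
have [x0 Kx0 G0] : exists2 x0, octahedron x0 & forall x, octahedron x -> G x0 <= G x.
  have [||| x0] := @compact_EVT_min _ R G octahedron.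
  - by exists (unit_row 0).
  - exact: octahedron_compact.
  - apply: continuous_in_subspaceT => x; rewrite inE => /octahedron_neq0 x0.
    by apply: (@cvg_finsum _ _ (nbhs x)) => i _; apply: cvg_norm; exact: gc.
  - rewrite inE => Kx0 G0; exists x0 => // x Kx; apply: G0; by rewrite inE.
have G_gt0 : 0 < G x0.
  rewrite lt_neqAle eq_sym sumr_ge0 ?andbT //; apply/eqP => Gx0.
  apply: nozero; exists x0; split=> // i iN.
  move/eqP: Gx0; rewrite psumr_eq0 // => /allP/(_ (Ordinal iN)).
  by rewrite mem_index_enum normr_eq0 => /(_ isT)/eqP.
have n0 : (0 < n)%N.
  by rewrite lt0n; apply/eqP => n0; move: G_gt0; rewrite /G n0 big_ord0 ltxx.
pose d := G x0 / n%:R; have d0 : 0 < d by rewrite divr_gt0 ?ltr0n.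
have big x : octahedron x -> has (fun i => d <= `|g i x|) (iota 0 n).
  move=> Kx; apply: contraT => /hasPn small; have := G0 _ Kx.
  rewrite leNgt (lt_le_trans (_ : _ < \sum_(i < n) d)) //.
    apply: ltr_sum; first by apply/hasP; exists (Ordinal n0); rewrite ?mem_index_enum.
    by move=> i _; rewrite ltNge small // mem_iota add0n ltn_ord.
  by rewrite sumr_const card_ord -mulr_natr mulfVK // pnatr_eq0 -lt0n.
have [e e_gt0 ge] : exists2 e, 0 < e & forall i x y, (i < n)%N -> octahedron x ->
    octahedron y -> `|x - y| < e -> `|g i x - g i y| < d.
  elim: (n) => [|m [e e_gt0 IH]]; first by exists 1.
  have [e' e'0 IH'] := octahedron_unif_continuous d0 (gc m).
  exists (Num.min e e'); first by rewrite lt_min e_gt0.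
  move=> i x y; rewrite ltnS leq_eqVlt => /predU1P[->|im] Kx Ky; rewrite lt_min => /andP[xe xe'].
    exact: IH'.
  exact: IH.
have [m me] : exists m, mesh_ratio R N ^+ m * 2 < e.
  have : (fun m => mesh_ratio R N ^+ m) @ \oo --> (0 : R).
    by apply: cvg_expr; rewrite ger0_norm ?mesh_ratio_ge0 ?mesh_ratio_lt1.
  move=> /cvgrPdist_lt /(_ (e / 2)); rewrite divr_gt0 // => /(_ isT) [m _ /(_ m)].
  rewrite /= leqnn => /(_ isT); rewrite sub0r normrN ger0_norm ?exprn_ge0 ?mesh_ratio_ge0 //.
  by rewrite ltr_pdivlMr // => ?; exists m.
pose idx x := find (fun i => d <= `|g i x|) (iota 0 n).
pose label x := ((0 < g (idx x) x)%R + (idx x).*2)%N.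
have idxP x : octahedron x -> (idx x < n)%N /\ d <= `|g (idx x) x|.
  move=> Kx; have := big _ Kx; move=> h; split.
    by move: (h); rewrite has_find size_iota.
  have := nth_find 0 h; rewrite -/(idx x) nth_iota ?add0n //.
  by move: h; rewrite has_find size_iota.
have halfl x : (label x)./2 = idx x by rewrite /label half_bit_double.
have oddl x : odd (label x) = (0 < g (idx x) x) 
  by rewrite /label oddD odd_double addbF; case: (_ < _).
apply: (no_fan_labelling (n := n) (label := label) (subdivided_hemisphere m)).
- move=> k s kn sk; have [[sg sgs] sm] := subdivided_fine (leq_ltn_trans kn nN) sk.
  move=> _ _ /mapP[x xs ->] /mapP[y ys ->]; rewrite !halfl => ixy.
  have Kx := orthant_octahedron (sgs _ xs); have Ky := orthant_octahedron (sgs _ ys).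
  rewrite /label ixy; congr (_ + _)%N; congr nat_of_bool.
  have [iN dx] := idxP _ Kx; have [_ dy] := idxP _ Ky.
  have := ge _ _ _ iN Kx Ky (le_lt_trans (sm _ _ xs ys) me).
  rewrite ixy in dx *; move: (g _ x) (g _ y) dx dy => a b.
  rewrite !ler_normr ltr_norml => /orP[] ? /orP[] ? /andP[? ?]; apply/idP/idP; lra.
- move=> k s x kn sk xs; have [[sg sgs] _] := subdivided_fine (leq_ltn_trans kn nN) sk.
  have Kx := orthant_octahedron (sgs _ xs); have [iN dx] := idxP _ Kx.
  split; first by rewrite halfl.
  have ixN : idx (- x) = idx x.
    by rewrite /idx; apply: eq_find => i; rewrite godd normrN.
  have gx0 : g (idx x) x != 0 by rewrite -normr_gt0 (lt_le_trans d0).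
  rewrite /antipode oddl /label ixN godd oppr_gt0.
  by case: (ltgtP (g (idx x) x) 0) gx0.
Qed.

End BorsukUlam.

(** * Scalar powers *)

Section ScalarPowers.
Variable R : realType.
Implicit Types (p r x y a b : R).

Lemma phi_p0 p : phi_p p 0 = 0 :> R. Proof. by rewrite /phi_p mulr0. Qed.

Lemma phi_pE p x : phi_p p x = Num.sg x * `|x| `^ (p - 1).
Proof.
have [->|x0] := eqVneq x 0; first by rewrite phi_p0 sgr0 mul0r.
rewrite /phi_p (_ : p - 2 = p - 1 - 1); last by ring.
rewrite powRB ?normr_eq0 ?x0 ?implybT // powRr1 // [in X in _ * X](numEsg x).
by field; rewrite normr_eq0.
Qed.

Lemma phi_pN p x : phi_p p (- x) = - phi_p p x.
Proof. by rewrite /phi_p normrN mulrN. Qed.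

Lemma phi_p1 p : phi_p p 1 = 1 :> R.
Proof. by rewrite /phi_p normr1 powR1 mulr1. Qed.

Lemma phi_pM p x y : phi_p p (x * y) = phi_p p x * phi_p p y.
Proof. by rewrite !phi_pE sgrM normrM powRM //; ring. Qed.

Lemma phi_p_gt0 p x : 0 < x -> 0 < phi_p p x.
Proof. by move=> x0; rewrite /phi_p mulr_gt0 // powR_gt0 // normr_gt0 gt_eqF. Qed.

Lemma phi_p_ge0 p x : 0 <= x -> 0 <= phi_p p x.
Proof. by move=> x0; rewrite /phi_p mulr_ge0 // powR_ge0. Qed.

Lemma phi_p_eq0 p x : (phi_p p x == 0) = (x == 0).
Proof.
rewrite /phi_p mulf_eq0 powR_eq0 normr_eq0.
by case: (x == 0); rewrite ?orbT.
Qed.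

Lemma mul_phi_p p x : 0 < p -> phi_p p x * x = `|x| `^ p.
Proof.
move=> p0; rewrite phi_pE mulrAC -normrEsg.
exact: mulr_powRB1.
Qed.

Lemma norm_phi_p p x : 1 < p -> `|phi_p p x| = `|x| `^ (p - 1).
Proof.
move=> p1; rewrite phi_pE normrM normr_sg (ger0_norm (powR_ge0 _ _)).
have [->|x0] := eqVneq x 0; last by rewrite mul1r.
by rewrite normr0 powR0 ?mulr0 // subr_eq0 gt_eqF.
Qed.

Lemma phi_p_surj p y : 1 < p -> exists x, phi_p p x = y.
Proof.
move=> p1; exists (Num.sg y * `|y| `^ (p - 1)^-1).
rewrite phi_pM.
rewrite [X in _ * X]phi_pE (ger0_norm (powR_ge0 _ _)) -powRrM mulVf ?powRr1 //; last first.
  by rewrite subr_eq0 gt_eqF.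
have [->|y0] := eqVneq y 0; first by rewrite normr0 !mulr0.
rewrite (gtr0_sg (powR_gt0 _ _)) ?normr_gt0 // mul1r.
have sgE : phi_p p (Num.sg y) = Num.sg y.
  by rewrite phi_pE sgr_id normr_sg y0 powR1 mulr1.
by rewrite sgE -numEsg.
Qed.

Lemma phi_p_inj p : 1 < p -> injective (phi_p p).
Proof.
move=> p1 x y; rewrite !phi_pE => xy.
have xy' : `|x| = `|y|.
  have := congr1 Num.norm xy; rewrite -!phi_pE !norm_phi_p //.
  by apply: powR_injective; rewrite ?subr_gt0 ?nnegrE.
have [x0|x0] := eqVneq x 0.
  by move/eqP: xy'; rewrite x0 normr0 eq_sym normr_eq0 => /eqP ->.
rewrite (numEsg x) (numEsg y) -xy'; congr (_ * _).
move: xy; rewrite -xy'; apply: mulIf.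
by rewrite gt_eqF // powR_gt0 // normr_gt0.
Qed.

Lemma phi_p_gtN1 p x : 1 < p -> 0 < 1 + x -> 0 < 1 + phi_p p x.
Proof.
move=> p1 x1; have [x0|x0] := leP 0 x; first by rewrite ltr_pwDl ?phi_p_ge0.
rewrite -[phi_p p x]opprK -phi_pN subr_gt0 phi_pE gtr0_sg ?oppr_gt0 // mul1r.
rewrite normrN ltr0_norm // -[ltRHS](congr1 (@^~ (p - 1)) (powR1 R)).
by apply: gt0_ltr_powR; rewrite ?nnegrE //; lra.
Qed.

Lemma phi_p_ltN1 p x : 1 < p -> 1 + x < 0 -> 1 + phi_p p x < 0.
Proof.
move=> p1 x1; have x0 : x < 0 by lra.
rewrite -[phi_p p x]opprK -phi_pN subr_lt0 phi_pE gtr0_sg ?oppr_gt0 // mul1r.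
rewrite normrN ltr0_norm // -[ltLHS](congr1 (@^~ (p - 1)) (powR1 R)).
by apply: gt0_ltr_powR; rewrite ?nnegrE //; lra.
Qed.

(** The convex function [|x|^p] lies above its tangents; by Young's inequality
    applied to [b] and [phi_p p a]. *)
Lemma powR_tangent p a b : 1 < p ->
  `|a| `^ p + p * phi_p p a * (b - a) <= `|b| `^ p.
Proof.
move=> p1; have p0 : 0 < p by lra.
have q0 : p - 1 != 0 by lra.
pose q := p / (p - 1).
have pq : p^-1 + q^-1 = 1 by rewrite /q; field; rewrite q0 gt_eqF.
have := @conjugate_powR R `|b| (`|a| `^ (p - 1)) p q (normr_ge0 _) (powR_ge0 _ _) p0.
have -> : (`|a| `^ (p - 1)) `^ q = `|a| `^ p.
  by rewrite -powRrM /q; congr (_ `^ _); field.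
move=> /(_ _ pq); rewrite /q divr_gt0 ?subr_gt0 // => /(_ isT) young.
have ab : phi_p p a * b <= `|b| * `|a| `^ (p - 1).
  by rewrite (le_trans (ler_norm _))// normrM norm_phi_p // mulrC.
have := le_trans ab young; rewrite -(ler_pM2l p0).
have -> : p * (`|b| `^ p / p + `|a| `^ p / (p / (p - 1))) = `|b| `^ p + (p - 1) * `|a| `^ p.
  by field; rewrite q0 gt_eqF.
by rewrite -(@mul_phi_p p a) //; move: (`|b| `^ p) => B; nra.
Qed.

Lemma continuous_norm_powR_neq0 r x : x != 0 ->
  {for x, continuous (fun y : R => `|y| `^ r)}.
Proof.
move=> x0; apply: (@cvg_trans _ (expR (r * ln `|y|) @[y --> x])).
  apply: near_eq_cvg; near=> y; rewrite /powR normr_eq0 (_ : (y == 0) = false) //.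
  apply/negbTE; near: y; apply/nbhs_ballP; exists `|x| => /=.
    by rewrite normr_gt0.
  move=> y /=; apply: contraTneq => ->.
  by rewrite subr0 ltxx.
rewrite /powR normr_eq0 (negbTE x0).
apply: (@cvg_comp _ _ _ (fun y => r * ln `|y|) expR _ (nbhs (r * ln `|x|))); last first.
  exact: continuous_expR.
apply: cvgM; first exact: cvg_cst.
apply: (@cvg_comp _ _ _ (fun y : R => `|y|) (@ln R) _ (nbhs `|x|)); last first.
  by apply: continuous_ln; rewrite normr_gt0.
exact: norm_continuous.
Unshelve. all: by end_near.
Qed.

Lemma continuous_norm_powR r : 0 < r -> continuous (fun y : R => `|y| `^ r).
Proof.
move=> r0 x; have [->|x0] := eqVneq x 0; last exact: continuous_norm_powR_neq0.
apply/cvgrPdist_lt => e e0; near=> y.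
rewrite normr0 powR0 ?gt_eqF // sub0r normrN ger0_norm ?powR_ge0 //.
rewrite -[e]powRr1 ?ltW // -(@mulVf _ r) ?gt_eqF // powRrM.
apply: gt0_ltr_powR; rewrite ?nnegrE ?powR_ge0 // -[y]subr0 distrC.
near: y; apply/nbhs_ballP; exists (e `^ r^-1) => /=; first exact: powR_gt0.
by move=> y /=; rewrite distrC.
Unshelve. all: by end_near.
Qed.

Lemma continuous_phi_p p : 1 < p -> continuous (phi_p p : R -> R).
Proof.
move=> p1 x; have [->|x0] := eqVneq x 0; last first.
  by apply: cvgM; [exact: continuous_norm_powR_neq0|exact: cvg_id].
rewrite /continuous_at phi_p0; apply/norm_cvg0P.
under eq_cvg do rewrite norm_phi_p //.
have := @continuous_norm_powR (p - 1) _ 0.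
rewrite /continuous_at normr0 powR0 ?subr_eq0 ?gt_eqF //; apply; by rewrite subr_gt0.
Qed.

End ScalarPowers.

(** * The two-point form of an edge *)

Section EdgeForm.
Variables (R : realType) (p : R).
Hypothesis p1 : 1 < p.
Implicit Types (x y t s : R).

Let p0 : 0 < p. Proof. exact: lt_trans p1. Qed.

Lemma norm_powRM x y : `|x * y| `^ p = `|x| `^ p * `|y| `^ p.
Proof. by rewrite normrM powRM. Qed.

(** The energy of a leaf [x] with potential [phi_p t], joined by an edge of weight
    1 to [y], minus the critical value [phi_p (t / (1 + t)) |y|^p] that it takes at
    [x = y / (1 + t)]. *)
Definition edge_form t x y :=
  `|x - y| `^ p + phi_p p t * `|x| `^ p - phi_p p (t / (1 + t)) * `|y| `^ p.

(** For [s >= 0] the form is convex in [x], so its critical point is a minimum: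
    add up the tangents there. *)
Lemma edge_form_ge0_convex s x y : 0 <= s -> 0 <= edge_form s x y.
Proof.
move=> s0; have s1 : 1 + s != 0 by lra.
(* [c] is the critical point of the form in [x] *)
pose r := (1 + s)^-1; pose c := r * y.
have cE : c - y = - (s * c) by rewrite /c /r; field.
have tx := powR_tangent c x p1.
have ty := powR_tangent (c - y) (x - y) p1.
have rE : `|c| `^ p = phi_p p r * r * `|y| `^ p by rewrite /c norm_powRM mul_phi_p.
have sE : `|c - y| `^ p = phi_p p s * s * `|c| `^ p.
  by rewrite cE normrN norm_powRM mul_phi_p.
have fE : phi_p p (c - y) = - (phi_p p s * phi_p p c) by rewrite cE phi_pN phi_pM.
rewrite /edge_form phi_pM -/r subr_ge0.
have -> : phi_p p s * phi_p p r * `|y| `^ p = phi_p p s * s * `|c| `^ p + phi_p p s * `|c| `^ p.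
  by rewrite rE /r; field.
have fs : 0 <= phi_p p s by exact: phi_p_ge0.
move: ty; rewrite sE fE (_ : x - y - (c - y) = x - c); last by ring.
move=> ty; have {}tx := ler_wpM2l fs tx.
apply: le_trans (lerD ty tx); rewrite le_eqVlt; apply/orP; left; apply/eqP; ring.
Qed.

(** For negative [t] the form is convex in [y] instead, and the roles of [x] and
    [y] are exchanged. *)
Lemma edge_form_ge0 t x y : 0 < 1 + t -> 0 <= edge_form t x y.
Proof.
move=> t1; have [/edge_form_ge0_convex//|t0] := leP 0 t.
have t1' : 1 + t != 0 by rewrite gt_eqF.
have s0 : 0 <= - t / (1 + t) by rewrite divr_ge0 ?ltW // oppr_gt0.
have := edge_form_ge0_convex y x s0; rewrite /edge_form.
have -> : - t / (1 + t) / (1 + - t / (1 + t)) = - t.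
  by field; rewrite t1'; lra.
by rewrite mulNr !phi_pN distrC; lra.
Qed.

(** For [1 + t < 0] the roles of [y] and [x - y] are exchanged, up to a positive
    factor. *)
Lemma edge_form_le0 t x y : 1 + t < 0 -> edge_form t x y <= 0.
Proof.
move=> t1; have t1' : 1 + t != 0 by rewrite lt_eqF.
have t0 : t != 0 by rewrite lt_eqF //; lra.
have s0 : 0 <= - (1 + t) by lra.
have := edge_form_ge0_convex x (x - y) s0; rewrite /edge_form.
have -> : - (1 + t) / (1 + - (1 + t)) = (t / (1 + t))^-1.
  by field; rewrite t0 t1' /=; lra.
have -> : x - (x - y) = y by ring.
have r0 : 0 < t / (1 + t) by rewrite ltr_ndivlMr // mul0r; lra.
have fr := phi_p_gt0 p r0.
have -> : phi_p p (t / (1 + t))^-1 = (phi_p p (t / (1 + t)))^-1.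
  apply: (mulIf (lt0r_neq0 fr)); rewrite mulVf ?gt_eqF // -phi_pM mulVf ?phi_p1 //.
  by rewrite gt_eqF.
have fE : phi_p p (t / (1 + t)) * phi_p p (- (1 + t)) = - phi_p p t.
  by rewrite -phi_pM -phi_pN; congr phi_p; field.
rewrite -(pmulr_rge0 _ fr) mulrBr mulrDr (mulrA _ (phi_p p (- _))) fE.
by rewrite mulVKf ?gt_eqF //; lra.
Qed.

Lemma edge_form_eq0 t x : 1 + t != 0 -> edge_form t x ((1 + t) * x) = 0.
Proof.
move=> t1; rewrite /edge_form (_ : x - (1 + t) * x = - (t * x)); last by ring.
rewrite normrN !norm_powRM -(mul_phi_p t p0) -(mul_phi_p (1 + t) p0).
have <- : phi_p p (t / (1 + t)) * phi_p p (1 + t) = phi_p p t.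
  by rewrite -phi_pM divfK.
ring.
Qed.

End EdgeForm.

(** * Odd codimension and inertia *)

Section OddCodim.
Variables (R : realType).

Record oddfun (X : finType) := OddFun {
  oddfun_fun :> (X -> R) -> R;
  oddfun_continuous : continuous oddfun_fun;
  oddfunN : forall f, oddfun_fun (- f) = - oddfun_fun f }.

Definition vanish (X : finType) (hs : seq (oddfun X)) (f : X -> R) :=
  all (fun h : oddfun X => h f == 0) hs.

Definition odd_codim (X : finType) (n : nat) (P : (X -> R) -> Prop) :=
  exists2 hs : seq (oddfun X), size hs = n & forall f, vanish hs f -> P f.

Lemma odd_codim0 (X : finType) (P : (X -> R) -> Prop) : (forall f, P f) -> odd_codim 0 P.
Proof. by move=> PP; exists [::]. Qed.

Lemma odd_codimW (X : finType) n (P P' : (X -> R) -> Prop) :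
  odd_codim n P -> (forall f, P f -> P' f) -> odd_codim n P'.
Proof. by move=> [hs sz hP] PP'; exists hs => // f /hP/PP'. Qed.

Lemma odd_codimS (X : finType) n (P P' : (X -> R) -> Prop) (h : oddfun X) :
  odd_codim n P -> (forall f, h f = 0 -> P f -> P' f) -> odd_codim n.+1 P'.
Proof.
move=> [hs sz hP] PP'; exists (h :: hs) => [|f /andP[/eqP hf /hP]]; first by rewrite /= sz.
exact: PP'.
Qed.

Lemma odd_codim_family (X : finType) k (n : 'I_k -> nat) (P : 'I_k -> (X -> R) -> Prop) :
  (forall i, odd_codim (n i) (P i)) ->
  odd_codim (\sum_i n i) (fun f => forall i, P i f).
Proof.
move=> nP; have /choice[hs hsP] : forall i, exists hs : seq (oddfun X),
    size hs = n i /\ forall f, vanish hs f -> P i f.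
  by move=> i; have [hs] := nP i; exists hs.
exists (flatten [seq hs i | i <- enum 'I_k]).
  rewrite size_flatten /shape -map_comp sumnE big_map big_enum /=.
  by apply: eq_bigr => i _; have [] := hsP i.
move=> f fv i; apply: (hsP i).2.
have: all (fun j => vanish (hs j) f) (enum 'I_k).
  elim: (enum _) fv => //= j s IH; rewrite /vanish all_cat => /andP[->].
  exact: IH.
by move/allP; apply; rewrite mem_enum.
Qed.

Lemma odd_codim_comp (X Y : finType) (e : (X -> R) -> (Y -> R)) n (P : (Y -> R) -> Prop) :
  continuous e -> (forall f, e (- f) = - e f) ->
  odd_codim n P -> odd_codim n (P \o e).
Proof.
move=> ec eN [hs sz hP].
have hc (h : oddfun Y) : continuous (h \o e).
  by move=> f; apply: continuous_comp; [exact: ec|exact: oddfun_continuous].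
have hN (h : oddfun Y) f : (h \o e) (- f) = - (h \o e) f by rewrite /= eN oddfunN.
exists [seq OddFun (hc h) (hN h) | h <- hs]; first by rewrite size_map.
by move=> f fv; apply: hP; move: fv; rewrite /vanish all_map.
Qed.

(** For a quadratic form [Q], with [Eig] its radical and [Z] the zero vector, the
    numbers [a], [z], [b] of negative, zero and positive squares satisfy these
    conditions with linear functions. *)
Record inertia (X : finType) (Q : (X -> R) -> R) (Eig Z : (X -> R) -> Prop)
    (a z b : nat) : Prop := Inertia {
  inertia_ge0 : odd_codim a (fun f => 0 <= Q f);
  inertia_gt0 : odd_codim (a + z) (fun f => 0 < Q f \/ Z f);
  inertia_le0 : odd_codim b (fun f => Q f <= 0);
  inertia_lt0 : odd_codim (b + z) (fun f => Q f < 0 \/ Z f);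
  inertia_eig0 : odd_codim z (fun f => Eig f -> Z f);
  inertia_eig : odd_codim (a + b) Eig }.

Lemma inertia_opp (X : finType) (Q : (X -> R) -> R) Eig Z a z b :
  inertia Q Eig Z a z b -> inertia (fun f => - Q f) Eig Z b z a.
Proof.
move=> [i1 i2 i3 i4 i5 i6]; split=> //.
- by apply: odd_codimW i3 _ => f; rewrite oppr_ge0.
- by apply: odd_codimW i4 _ => f; rewrite oppr_gt0.
- by apply: odd_codimW i1 _ => f; rewrite oppr_le0.
- by apply: odd_codimW i2 _ => f; rewrite oppr_lt0.
- by rewrite addnC.
Qed.

(** Removal of vertices splits the energy as [Q = Q' + E], where [Q'] is the energy
    of the remaining graph and [E] the contribution of the removed vertices. *)
Section Steps.
Variables (X : finType) (Q Q' E : (X -> R) -> R) (Eig Eig' Z Z' : (X -> R) -> Prop).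
Hypothesis QE : forall f, Q f = Q' f + E f.
Hypothesis Z'Q' : forall f, Z' f -> Q' f = 0.

Lemma inertia_pos_step a z b (h : oddfun X) :
  (forall f, 0 <= E f) -> (forall f, h f = 0 -> E f = 0) ->
  (forall f, Z' f -> 0 < E f \/ Z f) ->
  (forall f, Z' f -> h f = 0 -> Z f) ->
  (forall f, Eig f <-> Eig' f /\ h f = 0) ->
  inertia Q' Eig' Z' a z b -> inertia Q Eig Z a z b.+1.
Proof.
move=> E0 hE ZE Zh EigE [i1 i2 i3 i4 i5 i6]; split.
- by apply: odd_codimW i1 _ => f Q0; rewrite QE addr_ge0.
- apply: odd_codimW i2 _ => f [Q0|Z0].
    by left; rewrite QE ltr_wpDr.
  by rewrite QE (Z'Q' Z0) add0r; exact: ZE.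
- by apply: (odd_codimS (h := h) i3) => f hf Q0; rewrite QE (hE _ hf) addr0.
- rewrite addSn; apply: (odd_codimS (h := h) i4) => f hf [Q0|Z0].
    by left; rewrite QE (hE _ hf) addr0.
  by right; exact: Zh.
- by apply: odd_codimW i5 _ => f Zf /EigE[/Zf ?]; exact: Zh.
- by rewrite addnS; apply: (odd_codimS (h := h) i6) => f hf ef; apply/EigE.
Qed.

Lemma inertia_zero_step a z b (h : oddfun X) :
  (forall f, E f = 0) ->
  (forall f, Z' f -> h f = 0 -> Z f) ->
  (forall f, Eig f <-> Eig' f) ->
  inertia Q' Eig' Z' a z b -> inertia Q Eig Z a z.+1 b.
Proof.
move=> E0 Zh EigE [i1 i2 i3 i4 i5 i6].
have QQ' f : Q f = Q' f by rewrite QE E0 addr0.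
split.
- by apply: odd_codimW i1 _ => f; rewrite QQ'.
- rewrite addnS; apply: (odd_codimS (h := h) i2) => f hf [Q0|Z0].
    by left; rewrite QQ'.
  by right; exact: Zh.
- by apply: odd_codimW i3 _ => f; rewrite QQ'.
- rewrite addnS; apply: (odd_codimS (h := h) i4) => f hf [Q0|Z0].
    by left; rewrite QQ'.
  by right; exact: Zh.
- by apply: (odd_codimS (h := h) i5) => f hf Zf /EigE/Zf ?; exact: Zh.
- by apply: odd_codimW i6 _ => f /EigE.
Qed.

(** [E] behaves as a hyperbolic plane does: it vanishes on the line [y = 0], and
    there are a line [hp = 0] where it is positive and a line [hm = 0] where it is
    negative, away from the origin [y = h = 0]. *)
Lemma inertia_pair_step a z b (y h hp hm : oddfun X) :
  (forall f, y f = 0 -> E f = 0) ->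
  (forall f, hp f = 0 -> 0 < E f \/ y f = 0 /\ h f = 0) ->
  (forall f, hm f = 0 -> E f < 0 \/ y f = 0 /\ h f = 0) ->
  (forall f, Z' f -> y f = 0 -> h f = 0 -> Z f) ->
  (forall f, Eig f <-> [/\ Eig' f, y f = 0 & h f = 0]) ->
  inertia Q' Eig' Z' a z b -> inertia Q Eig Z a.+1 z b.+1.
Proof.
move=> yE hpE hmE Zh EigE [i1 i2 i3 i4 i5 i6]; split.
- by apply: (odd_codimS (h := y) i1) => f yf Q0; rewrite QE (yE _ yf) addr0.
- rewrite addSn; apply: (odd_codimS (h := hp) i2) => f /hpE[E0|[y0 h0]] [Q0|Z0].
  + by left; rewrite QE addr_gt0.
  + by left; rewrite QE (Z'Q' Z0) add0r.
  + by left; rewrite QE (yE _ y0) addr0.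
  + by right; exact: Zh.
- apply: (odd_codimS (h := hm) i3) => f /hmE[E0|[y0 h0]] Q0.
  + by rewrite QE -oppr_ge0 opprD addr_ge0 ?oppr_ge0 // ltW.
  + by rewrite QE (yE _ y0) addr0.
- rewrite addSn; apply: (odd_codimS (h := hm) i4) => f /hmE[E0|[y0 h0]] [Q0|Z0].
  + by left; rewrite QE -oppr_gt0 opprD addr_gt0 ?oppr_gt0.
  + by left; rewrite QE (Z'Q' Z0) add0r.
  + by left; rewrite QE (yE _ y0) addr0.
  + by right; exact: Zh.
- by apply: odd_codimW i5 _ => f Zf /EigE[/Zf ? ? ?]; exact: Zh.
- rewrite addSn addnS; apply: (odd_codimS (h := y) (n := (a + b).+1)).
    by apply: (odd_codimS (h := h) i6) => f hf ef; exact: (conj hf ef).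
  by move=> f yf [hf ef]; apply/EigE.
Qed.

End Steps.

Lemma inertia_neg_step (X : finType) (Q Q' E : (X -> R) -> R)
    (Eig Eig' Z Z' : (X -> R) -> Prop) a z b (h : oddfun X) :
  (forall f, Q f = Q' f + E f) -> (forall f, Z' f -> Q' f = 0) ->
  (forall f, E f <= 0) -> (forall f, h f = 0 -> E f = 0) ->
  (forall f, Z' f -> E f < 0 \/ Z f) ->
  (forall f, Z' f -> h f = 0 -> Z f) ->
  (forall f, Eig f <-> Eig' f /\ h f = 0) ->
  inertia Q' Eig' Z' a z b -> inertia Q Eig Z a.+1 z b.
Proof.
move=> QE ZQ E0 hE ZE Zh EigE /inertia_opp i.
have /inertia_opp : inertia (fun f => - Q f) Eig Z b z a.+1.
  apply: (@inertia_pos_step _ (fun f => - Q f) (fun f => - Q' f) (fun f => - E f)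
    Eig Eig' Z Z' _ _ b z a h) i => //.
  - by move=> f; rewrite QE opprD.
  - by move=> f /ZQ ->; rewrite oppr0.
  - by move=> f; rewrite oppr_ge0.
  - by move=> f /hE ->; rewrite oppr0.
  - by move=> f /ZE; rewrite oppr_gt0.
by congr inertia; apply/funext => f; rewrite opprK.
Qed.

End OddCodim.

(** * Acyclic graphs *)

Section ContinuousRealFunctions.
Variables (R : realType) (T : topologicalType).
Implicit Types (f g : T -> R) (h : R -> R).

Lemma continuous_funD f g : continuous f -> continuous g ->
  continuous (fun x => f x + g x).
Proof. by move=> cf cg x; apply: cvgD; [exact: cf|exact: cg]. Qed.

Lemma continuous_funB f g : continuous f -> continuous g ->
  continuous (fun x => f x - g x).
Proof. by move=> cf cg x; apply: cvgB; [exact: cf|exact: cg]. Qed.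

Lemma continuous_funZ a f : continuous f -> continuous (fun x => a * f x).
Proof. by move=> cf x; apply: cvgM; [exact: cvg_cst|exact: cf]. Qed.

Lemma continuous_fun_comp h f : continuous h -> continuous f ->
  continuous (fun x => h (f x)).
Proof. by move=> ch cf x; apply: continuous_comp; [exact: cf|exact: ch]. Qed.

Lemma continuous_fun_sum (I : Type) (r : seq I) (P : pred I) (F : I -> T -> R) :
  (forall i, continuous (F i)) -> continuous (fun x => \sum_(i <- r | P i) F i x).
Proof. by move=> cF x; apply: (@cvg_finsum _ _ (nbhs x)) => i _; exact: cF. Qed.

End ContinuousRealFunctions.

Section Leaf.
Variables (V : finType) (e : rel V).
Hypotheses (e_irr : irreflexive e) (e_sym : symmetric e).
Hypothesis e_acyclic : forall c : seq V, (2 < size c)%N -> ~ ucycle e c.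

(** Otherwise every path in [S] can be extended at its head [x]: of two neighbours
    of [x], one is not the second vertex of the path, and if it lies on the path
    it closes a cycle. *)
Lemma acyclic_leaf (S : {set V}) : S != finset.set0 ->
  exists2 u, u \in S & {in S &, forall v w, e u v -> e u w -> v = w}.
Proof.
move=> /set0Pn[x0 x0S]; apply: contrapT => noleaf.
have two x : x \in S -> exists y z, [/\ y \in S, z \in S, e x y, e x z & y != z].
  move=> xS; apply: contrapT => no; apply: noleaf; exists x => // v w vS wS xv xw.
  by apply/eqP/negPn/negP => vw; apply: no; exists v, w.
have long n : exists x s, [/\ size s = n, uniq (x :: s), path e x s & all (mem S) (x :: s)].
  elim: n => [|n [x [s [sz us ps sS]]]].
    by exists x0, [::]; split=> //=; rewrite andbT.
  have xS : x \in S by case/andP: sS.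
  have out y : y \in S -> e x y -> y \notin s ->
      exists x s, [/\ size s = n.+1, uniq (x :: s), path e x s & all (mem S) (x :: s)].
    move=> yS xy ys; exists y, (x :: s); split.
    - by rewrite /= sz.
    - rewrite cons_uniq us inE (negbTE ys) orbF andbT.
      by apply: contraTneq xy => ->; rewrite e_irr.
    - by rewrite /= e_sym xy.
    - by apply/andP; split.
  have [y [z [yS zS xy xz yz]]] := two _ xS.
  have [ys|] := boolP (y \in s); last exact: out.
  have [zs|] := boolP (z \in s); last exact: out.
  (* one of the two neighbours is not the first vertex of s *)
  have [w [ws xw w1]] : exists w, [/\ w \in s, e x w & (0 < index w s)%N].
    have [y0|y0] := posnP (index y s); last by exists y.
    have [z0|z0] := posnP (index z s); last by exists z.
    by move: yz; rewrite -(nth_index x0 ys) -(nth_index x0 zs) y0 z0 eqxx.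
  have iw : (index w s < size s)%N by rewrite index_mem.
  case: (e_acyclic (c := x :: take (index w s).+1 s)).
    by rewrite /= size_takel.
  have st : s = take (index w s).+1 s ++ drop (index w s).+1 s by rewrite cat_take_drop.
  apply/andP; split; last by move: us; rewrite {1}st -cat_cons cat_uniq => /andP[].
  rewrite /cycle rcons_path; move: ps; rewrite {1}st cat_path => /andP[-> _] /=.
  by rewrite (take_nth x0) // last_rcons nth_index // e_sym.
have [x [s [sz us _ _]]] := long #|V|.
have := card_size (x :: s); have /card_uniqP -> := us.
by move/card_uniqP: us => us; have := max_card (mem (x :: s)); rewrite us /= sz ltnn.
Qed.

End Leaf.

Section EnergyInertia.
Variables (R : realType) (V : finType) (p : R).
Hypothesis p1 : 1 < p.
Variables (e : rel V) (W : V -> V -> R).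
Hypotheses (e_irr : irreflexive e) (e_sym : symmetric e).
Hypothesis e_acyclic : forall c : seq V, (2 < size c)%N -> ~ ucycle e c.
Hypothesis W_gt0 : forall u v, e u v -> 0 < W u v.
Hypothesis W_eq0 : forall u v, ~~ e u v -> W u v = 0.
Hypothesis W_sym : forall u v, W u v = W v u.

Implicit Types (S : {set V}) (c d f : V -> R) (u v w : V).

Let p0 : 0 < p. Proof. exact: lt_trans p1. Qed.
Let W_ge0 u v : 0 <= W u v.
Proof. by have [/W_gt0/ltW|/W_eq0 ->] := boolP (e u v). Qed.
Let Wii u : W u u = 0. Proof. by apply: W_eq0; rewrite e_irr. Qed.

(** Weights are extended by 0 to all pairs of vertices, which turns the sums over
    neighbours into sums over [S]. *)
Definition energy (S : {set V}) (c : V -> R) (f : V -> R) :=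
  (\sum_(u in S) \sum_(v in S) W u v * `|f u - f v| `^ p) / 2
  + \sum_(u in S) c u * `|f u| `^ p.

Definition gradient (S : {set V}) (c : V -> R) (f : V -> R) u :=
  \sum_(v in S) W u v * phi_p p (f u - f v) + c u * phi_p p (f u).

Definition critical S c f := forall u, u \in S -> gradient S c f u = 0.

Definition null_on (S : {set V}) (f : V -> R) := forall u, u \in S -> f u = 0.

Lemma energy_null S c f : null_on S f -> energy S c f = 0.
Proof.
move=> f0; rewrite /energy !big1 ?mul0r ?addr0 // => u uS.
  by rewrite f0 // normr0 powR0 ?mulr0 // gt_eqF.
rewrite big1 // => v vS.
by rewrite !f0 // subr0 normr0 powR0 ?mulr0 // gt_eqF.
Qed.

Lemma energyD1 S c f u : u \in S -> energy S c f = energy (S :\ u) c f +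
  (\sum_(v in S :\ u) W u v * `|f u - f v| `^ p + c u * `|f u| `^ p).
Proof.
move=> uS; rewrite /energy (big_setD1 u uS) /= (big_setD1 u uS) /= Wii mul0r add0r.
rewrite [X in _ / 2 + X](big_setD1 u uS) /=.
under [X in (_ + X) / 2]eq_bigr do rewrite (big_setD1 u uS) /=.
rewrite big_split /=.
have -> : \sum_(v in S :\ u) W v u * `|f v - f u| `^ p =
    \sum_(v in S :\ u) W u v * `|f u - f v| `^ p.
  by apply: eq_bigr => v _; rewrite W_sym distrC.
by field.
Qed.

Lemma gradientD1 S c f u w : u \in S ->
  gradient S c f w = gradient (S :\ u) c f w + W w u * phi_p p (f w - f u).
Proof. by move=> uS; rewrite /gradient (big_setD1 u uS) /=; ring. Qed.

Lemma energy_shift S c d f :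
  energy S (fun w => c w + d w) f = energy S c f + \sum_(w in S) d w * `|f w| `^ p.
Proof.
rewrite /energy -addrA -big_split /=; congr (_ + _).
by apply: eq_bigr => w _; rewrite mulrDl.
Qed.

Lemma gradient_shift S c d f w :
  gradient S (fun w => c w + d w) f w = gradient S c f w + d w * phi_p p (f w).
Proof. by rewrite /gradient mulrDl addrA. Qed.

Lemma null_onD1 S u f : u \in S -> null_on S f <-> null_on (S :\ u) f /\ f u = 0.
Proof.
move=> uS; split=> [f0|[f0 fu] w wS].
  by split=> [w|]; [rewrite !inE => /andP[_ /f0]|exact: f0].
by have [->//|wu] := eqVneq w u; apply: f0; rewrite !inE wu.
Qed.

Lemma coord_fun_continuous u : continuous (fun f : V -> R => f u).
Proof. exact: (@proj_continuous V (fun=> R) u). Qed.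

Lemma coord_odd u (f : V -> R) : (- f) u = - f u. Proof. by []. Qed.

Definition coord u := OddFun (@coord_fun_continuous u) (@coord_odd u).

Lemma isolated_inertia S c u a z b : u \in S -> {in S, forall v, ~~ e u v} ->
  inertia (energy (S :\ u) c) (critical (S :\ u) c) (null_on (S :\ u)) a z b ->
  exists a' z' b', [/\ a' + z' + b' = (a + z + b).+1 &
    inertia (energy S c) (critical S c) (null_on S) a' z' b']%N.
Proof.
move=> uS iu ind.
have Wu0 v : v \in S -> W u v = 0 by move=> /iu/W_eq0.
pose E (f : V -> R) := c u * `|f u| `^ p.
have QE f : energy S c f = energy (S :\ u) c f + E f.
  rewrite (energyD1 _ _ uS) big1 ?add0r // => v; rewrite !inE => /andP[_ vS].
  by rewrite Wu0 ?mul0r.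
have ZQ f : null_on (S :\ u) f -> energy (S :\ u) c f = 0 by exact: energy_null.
have gu f : gradient S c f u = c u * phi_p p (f u).
  by rewrite /gradient big1 ?add0r // => v vS; rewrite Wu0 ?mul0r.
have gw f w : w \in S :\ u -> gradient S c f w = gradient (S :\ u) c f w.
  rewrite !inE => /andP[_ wS].
  by rewrite (gradientD1 _ _ _ uS) W_sym Wu0 // mul0r addr0.
have critE f : critical S c f <-> critical (S :\ u) c f /\ c u * phi_p p (f u) = 0.
  split=> [cf|[cf fu] w wS].
    by split=> [w wS|]; rewrite -?gu ?cf // -gw // cf //; move: wS; rewrite inE => /andP[].
  by have [->|wu] := eqVneq w u; rewrite ?gu // gw ?cf // !inE wu.
have Zu f : null_on (S :\ u) f -> coord u f = 0 -> null_on S f.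
  by move=> f0 fu; apply/(null_onD1 _ uS).
have E0 f : coord u f = 0 -> E f = 0.
  by rewrite /= /E => ->; rewrite normr0 powR0 ?mulr0 // gt_eqF.
have critE' f : c u != 0 -> critical S c f <-> critical (S :\ u) c f /\ coord u f = 0.
  move=> cu; rewrite critE /=; split=> -[cf fu]; split=> //.
    by move/eqP: fu; rewrite mulf_eq0 (negbTE cu) phi_p_eq0 => /eqP.
  by rewrite fu phi_p0 mulr0.
have pow0 f : coord u f = 0 \/ 0 < `|f u| `^ p.
  rewrite /=; have [->|fu] := eqVneq (f u) 0; [by left|right].
  by rewrite powR_gt0 // normr_gt0.
have [cu|cu|cu] := ltgtP (c u) 0.
- exists a.+1, z, b; split; first by rewrite !addSn.
  apply: (@inertia_neg_step _ _ _ _ E _ _ _ _ _ _ _ (coord u)) ind => // [f|f f0|f].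
  + by rewrite /E mulr_le0_ge0 ?powR_ge0 // ltW.
  + have [fu|fu] := pow0 f; first by right; exact: Zu.
    by left; rewrite /E pmulr_llt0.
  + by apply: critE'; rewrite lt_eqF.
- exists a, z, b.+1; split; first by rewrite addnS.
  apply: (@inertia_pos_step _ _ _ _ E _ _ _ _ _ _ _ _ _ (coord u)) ind => // [f|f f0|f].
  + by rewrite /E mulr_ge0 ?powR_ge0 // ltW.
  + have [fu|fu] := pow0 f; first by right; exact: Zu.
    by left; rewrite /E pmulr_lgt0.
  + by apply: critE'; rewrite gt_eqF.
- exists a, z.+1, b; split; first by rewrite addnS addSn.
  apply: (@inertia_zero_step _ _ _ _ E _ _ _ _ _ _ _ _ (coord u)) ind => // f.
  + by rewrite /E cu mul0r.
  + by rewrite critE cu mul0r; split=> [[]|].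
Qed.

(** The condition [f v = (1 + t) * f u] is the gradient equation at the leaf, and
    it makes the two-point form of the edge vanish. *)
Lemma leaf_inertia S c u v t : u \in S -> v \in S -> e u v ->
  {in S, forall w, e u w -> w = v} -> 1 + t != 0 -> c u = W u v * phi_p p t ->
  let c' w := c w + (w == v)%:R * (W u v * phi_p p (t / (1 + t))) in
  forall a z b,
  inertia (energy (S :\ u) c') (critical (S :\ u) c') (null_on (S :\ u)) a z b ->
  exists a' z' b', [/\ a' + z' + b' = (a + z + b).+1 &
    inertia (energy S c) (critical S c) (null_on S) a' z' b']%N.
Proof.
move=> uS vS uv uniq_v t1 cu c' a z b ind.
have uv' : v != u by apply: contraTneq uv => ->; rewrite e_irr.
have vSu : v \in S :\ u by rewrite !inE uv'.
have Wu0 w : w \in S -> w != v -> W u w = 0.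
  by move=> wS wv; apply: W_eq0; apply: contra wv => /uniq_v ->.
have Wuv : 0 < W u v by exact: W_gt0.
have sum_v (F : V -> R) : \sum_(w in S :\ u) W u w * F w = W u v * F v.
  rewrite (bigD1 v) //= big1 ?addr0 // => w; rewrite !inE => /andP[/andP[_ wS] wv].
  by rewrite Wu0 ?mul0r.
have delta_v (F : V -> R) (x : R) : \sum_(w in S :\ u) (w == v)%:R * x * F w = x * F v.
  rewrite (bigD1 v) //= eqxx mul1r big1 ?addr0 // => w /andP[_ /negbTE ->].
  by rewrite !mul0r.
pose E f := W u v * edge_form p t (f u) (f v).
have QE f : energy S c f = energy (S :\ u) c' f + E f.
  rewrite (energyD1 _ _ uS) sum_v energy_shift delta_v /E /edge_form cu; ring.
have ZQ f : null_on (S :\ u) f -> energy (S :\ u) c' f = 0 by exact: energy_null.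
pose hf f := f v - (1 + t) * f u.
have hc : continuous hf.
  apply: continuous_funB; first exact: coord_fun_continuous.
  by apply: continuous_funZ; exact: coord_fun_continuous.
have hN f : hf (- f) = - hf f by rewrite /hf !coord_odd; ring.
pose h := OddFun hc hN.
have hE f : h f = 0 -> f v = (1 + t) * f u by move/eqP; rewrite subr_eq0 => /eqP.
have E0 f : h f = 0 -> E f = 0 by move/hE => fv; rewrite /E fv edge_form_eq0 ?mulr0.
have Zh f : null_on (S :\ u) f -> h f = 0 -> null_on S f.
  move=> f0 /hE; rewrite (f0 v) // => /esym/eqP; rewrite mulf_eq0 (negbTE t1) => /eqP fu.
  exact/(null_onD1 _ uS).
have gu f : gradient S c f u = W u v * (phi_p p (t * f u) - phi_p p (f v - f u)).
  rewrite (gradientD1 _ _ _ uS) Wii mul0r addr0 /gradient sum_v cu phi_pM.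
  by rewrite -[f u - f v]opprB phi_pN; ring.
have gw f w : w \in S :\ u -> h f = 0 -> gradient S c f w = gradient (S :\ u) c' f w.
  move=> wSu /hE fv; rewrite (gradientD1 _ _ _ uS) gradient_shift W_sym; congr (_ + _).
  have [->|wv] := eqVneq w v; last by rewrite Wu0 ?mul0r //; move: wSu; rewrite inE => /andP[].
  rewrite mul1r -mulrA -phi_pM fv; congr (_ * phi_p p _); by field.
have critE f : critical S c f <-> critical (S :\ u) c' f /\ h f = 0.
  have crit_h : gradient S c f u = 0 <-> h f = 0.
    rewrite gu; split=> [/eqP|/hE ->].
      rewrite mulf_eq0 gt_eqF //= subr_eq0 => /eqP/(phi_p_inj p1) tf.
      by rewrite /= /hf mulrDl tf; ring.
    by rewrite (_ : _ - f u = t * f u) ?subrr ?mulr0 //; ring.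
  split=> [cf|[cf fh] w wS].
    have fh : h f = 0 by apply/crit_h/cf.
    by split=> // w wSu; rewrite -gw // cf //; move: wSu; rewrite inE => /andP[].
  have [->|wu] := eqVneq w u; first exact/crit_h.
  have wSu : w \in S :\ u by rewrite !inE wu.
  by rewrite gw // cf.
have Ev f : null_on (S :\ u) f -> E f = W u v * (1 + phi_p p t) * `|f u| `^ p.
  by move=> f0; rewrite /E /edge_form (f0 v) // subr0 normr0 powR0 ?gt_eqF //; ring.
have pow0 f : null_on (S :\ u) f -> null_on S f \/ 0 < `|f u| `^ p.
  move=> f0; have [fu|fu] := eqVneq (f u) 0; [left|right].
    exact/(null_onD1 _ uS).
  by rewrite powR_gt0 // normr_gt0.
have [t0|t0|t0] := ltgtP (1 + t) 0; last by rewrite t0 eqxx in t1.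
- exists a.+1, z, b; split; first by rewrite !addSn.
  apply: (@inertia_neg_step _ _ _ _ E _ _ _ _ _ _ _ h) ind => // [f|f f0].
  + by rewrite /E pmulr_rle0 // edge_form_le0.
  + have [|fu] := pow0 _ f0; first by right.
    by left; rewrite Ev // pmulr_llt0 // pmulr_rlt0 // phi_p_ltN1.
- exists a, z, b.+1; split; first by rewrite addnS.
  apply: (@inertia_pos_step _ _ _ _ E _ _ _ _ _ _ _ _ _ h) ind => // [f|f f0].
  + by rewrite /E mulr_ge0 // edge_form_ge0.
  + have [|fu] := pow0 _ f0; first by right.
    by left; rewrite Ev // mulr_gt0 // mulr_gt0 // phi_p_gtN1.
Qed.

(** The gradient at the leaf is [w * (phi_p (f u - f v) - phi_p (f u))], so a
    critical [f] vanishes at [v].  The energy of the edges at [v], minus its value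
    for [f v = 0], is convex in [f v], so it lies between the bounds given by the
    tangents at 0 and at [f v].  Two odd conditions prescribe the slopes of these
    tangents and make the lower bound a large positive multiple of [|f v|^p], and
    the upper bound a large negative one. *)
Lemma singular_leaf_inertia S c u v : u \in S -> v \in S -> e u v ->
  {in S, forall w, e u w -> w = v} -> c u = - W u v ->
  let c' w := c w + W v w in
  forall a z b,
  inertia (energy (S :\ v :\ u) c') (critical (S :\ v :\ u) c')
    (null_on (S :\ v :\ u)) a z b ->
  inertia (energy S c) (critical S c) (null_on S) a.+1 z b.+1.
Proof.
move=> uS vS uv uniq_v cu c' a z b ind.
have uv' : u != v by apply: contraTneq uv => ->; rewrite e_irr.
have uSv : u \in S :\ v by rewrite !inE uv'.
have sub w : w \in S :\ v :\ u -> [/\ w != u, w != v & w \in S].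
  by rewrite !inE => /and3P[].
have Wuv : 0 < W u v by exact: W_gt0.
have Wu0 w : w \in S -> w != v -> W u w = 0.
  by move=> wS wv; apply: W_eq0; apply: contra wv => /uniq_v ->.
pose s f := \sum_(w in S :\ v) W v w * phi_p p (f v - f w).
pose s0 f := \sum_(w in S :\ v) W v w * phi_p p (f w).
pose E f := \sum_(w in S :\ v) W v w * (`|f v - f w| `^ p - `|f w| `^ p) + c v * `|f v| `^ p.
(* the tangent bounds gain [p * K * |f v|^p], which exceeds [|c v| * |f v|^p] *)
pose K := 1 + `|c v|.
have QE f : energy S c f = energy (S :\ v :\ u) c' f + E f.
  rewrite (energyD1 _ _ vS) (energyD1 _ _ uSv) energy_shift.
  rewrite [\sum_(w in S :\ v :\ u) W u w * _]big1; last first.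
    by move=> w /sub[_ wv wS]; rewrite Wu0 ?mul0r.
  rewrite /E; under [X in _ = _ + (X + _)]eq_bigr do rewrite mulrBr.
  rewrite sumrB [\sum_(i in S :\ v) W v i * `|f i| `^ p](big_setD1 u uSv) /= cu (W_sym v u).
  by ring.
have ZQ f : null_on (S :\ v :\ u) f -> energy (S :\ v :\ u) c' f = 0.
  exact: energy_null.
have phic u' : continuous (fun f : V -> R => phi_p p (f u')).
  by apply: continuous_fun_comp; [exact: continuous_phi_p|exact: coord_fun_continuous].
have s0c : continuous s0.
  by apply: continuous_fun_sum => w; apply: continuous_funZ; exact: phic.
have sc : continuous s.
  apply: continuous_fun_sum => w; apply: continuous_funZ.
  apply: continuous_fun_comp; first exact: continuous_phi_p.
  by apply: continuous_funB; exact: coord_fun_continuous.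
have s0N f : s0 (- f) = - s0 f.
  by rewrite /s0 -sumrN; apply: eq_bigr => w _; rewrite coord_odd phi_pN mulrN.
have sN f : s (- f) = - s f.
  rewrite /s -sumrN; apply: eq_bigr => w _.
  by rewrite !coord_odd -opprD phi_pN mulrN.
have hpc : continuous (fun f => K * phi_p p (f v) + s0 f).
  by apply: continuous_funD => //; apply: continuous_funZ; exact: phic.
have hmc : continuous (fun f => K * phi_p p (f v) + s f).
  by apply: continuous_funD => //; apply: continuous_funZ; exact: phic.
have hpN f : K * phi_p p ((- f) v) + s0 (- f) = - (K * phi_p p (f v) + s0 f).
  by rewrite coord_odd phi_pN s0N; ring.
have hmN f : K * phi_p p ((- f) v) + s (- f) = - (K * phi_p p (f v) + s f).
  by rewrite coord_odd phi_pN sN; ring.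
have s_y0 f : f v = 0 -> s f = - s0 f.
  move=> fv; rewrite /s /s0 -sumrN; apply: eq_bigr => w _.
  by rewrite fv sub0r phi_pN mulrN.
have E_ge f : - p * s0 f * f v + c v * `|f v| `^ p <= E f.
  rewrite /E lerD2r mulrAC mulr_sumr; apply: ler_sum => w _.
  rewrite mulrCA ler_wpM2l //.
  have := powR_tangent (- f w) (f v - f w) p1; rewrite normrN phi_pN.
  rewrite (_ : f v - f w - - f w = f v); last by ring.
  by move: (`|f v - f w| `^ p) (`|f w| `^ p) => A B; lra.
have E_le f : E f <= p * s f * f v + c v * `|f v| `^ p.
  rewrite /E lerD2r mulrAC mulr_sumr; apply: ler_sum => w _.
  rewrite mulrCA ler_wpM2l //.
  have := powR_tangent (f v - f w) (- f w) p1; rewrite normrN.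
  rewrite (_ : - f w - (f v - f w) = - f v); last by ring.
  by move: (`|f v - f w| `^ p) (`|f w| `^ p) => A B; lra.
have cK : `|c v| < p * K.
  apply: (@lt_le_trans _ _ K); first by rewrite /K ltrDr.
  by apply: ler_peMl; [rewrite /K addr_ge0|exact: ltW].
have pow0 f : f v = 0 \/ 0 < `|f v| `^ p.
  by have [->|fv] := eqVneq (f v) 0; [left|right; rewrite powR_gt0 // normr_gt0].
apply: (@inertia_pair_step _ _ _ _ E _ _ _ _ _ _ _ _ _
  (coord v) (OddFun s0c s0N) (OddFun hpc hpN) (OddFun hmc hmN)) ind => //=.
- move=> f fv; rewrite /E fv normr0 powR0 ?gt_eqF // mulr0 addr0 big1 // => w _.
  by rewrite sub0r normrN subrr mulr0.
- move=> f fh; have [fv|fv] := pow0 f.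
    by right; split=> //; move: fh; rewrite fv phi_p0 mulr0 add0r.
  left; apply: lt_le_trans (E_ge f).
  have -> : s0 f = - (K * phi_p p (f v)) by apply/eqP; rewrite -addr_eq0 addrC fh.
  have -> : - p * - (K * phi_p p (f v)) * f v = p * K * `|f v| `^ p.
    by rewrite -(mul_phi_p (f v) p0); ring.
  rewrite -mulrDl mulr_gt0 //.
  by have := ler_norm (- c v); rewrite normrN; lra.
- move=> f fh; have [fv|fv] := pow0 f.
    right; split=> //; move: fh; rewrite fv phi_p0 mulr0 add0r s_y0 // => /eqP.
    by rewrite oppr_eq0 => /eqP.
  left; apply: le_lt_trans (E_le f) _.
  have -> : s f = - (K * phi_p p (f v)) by apply/eqP; rewrite -addr_eq0 addrC fh.
  have -> : p * - (K * phi_p p (f v)) * f v = - (p * K) * `|f v| `^ p.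
    by rewrite -(mul_phi_p (f v) p0); ring.
  rewrite -mulrDl pmulr_llt0 //.
  by have := ler_norm (c v); lra.
- move=> f f0 fv s00; apply/(null_onD1 _ vS); split=> //.
  apply/(null_onD1 _ uSv); split=> //; move: s00.
  rewrite /s0 (big_setD1 u uSv) /= big1 ?addr0; last first.
    by move=> w wS; rewrite f0 // phi_p0 mulr0.
  by move/eqP; rewrite mulf_eq0 W_sym gt_eqF //= phi_p_eq0 => /eqP.
- move=> f.
  have gu : gradient S c f u = W u v * (phi_p p (f u - f v) - phi_p p (f u)).
    rewrite (gradientD1 _ _ _ vS) /gradient big1; first by rewrite cu; ring.
    by move=> w; rewrite !inE => /andP[wv wS]; rewrite Wu0 ?mul0r.
  have gv : gradient S c f v = s f + c v * phi_p p (f v).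
    by rewrite (gradientD1 _ _ _ vS) Wii mul0r addr0.
  have gw w : w \in S :\ v :\ u -> f v = 0 ->
      gradient S c f w = gradient (S :\ v :\ u) c' f w.
    move=> /sub[_ wv wS] fv; rewrite (gradientD1 _ _ _ vS) (gradientD1 _ _ _ uSv).
    by rewrite gradient_shift fv subr0 (W_sym w u) Wu0 // mul0r addr0 (W_sym v w).
  split=> [cf|[cf fv s00] w wS].
    have fv : f v = 0.
      have /eqP := cf u uS; rewrite gu mulf_eq0 gt_eqF //= subr_eq0 => /eqP/(phi_p_inj p1).
      by move=> h; have -> : f v = f u - (f u - f v); [ring|rewrite h subrr].
    split=> //; first by move=> w wS; rewrite -gw // cf //; have [] := sub _ wS.
    have /eqP := cf v vS; rewrite gv fv phi_p0 mulr0 addr0 s_y0 // oppr_eq0.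
    by move/eqP.
  have [->|wv] := eqVneq w v; first by rewrite gv fv phi_p0 mulr0 addr0 s_y0 // s00 oppr0.
  have [->|wu] := eqVneq w u; first by rewrite gu fv subr0 subrr mulr0.
  have wS' : w \in S :\ v :\ u by rewrite !inE wu wv.
  by rewrite gw // cf.
Qed.

Theorem acyclic_inertia S c : exists a z b, [/\ a + z + b = #|S| &
  inertia (energy S c) (critical S c) (null_on S) a z b]%N.
Proof.
move: {2}#|S| (leqnn #|S|) => n; elim: n S c => [|n IH] S c.
  rewrite leqn0 cards_eq0 => /eqP ->; exists 0%N, 0%N, 0%N; rewrite cards0.
  split=> //; have c0 : critical finset.set0 c = fun=> True.
    by apply/funext => f; apply/propext; split=> // _ u; rewrite inE.
  have n0 f : null_on finset.set0 f by move=> u; rewrite inE.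
  by split; apply: odd_codim0 => f; rewrite ?energy_null ?c0 //; right.
have [->|S0] := eqVneq S finset.set0; first by move=> _; apply: IH; rewrite cards0.
move=> Sn; have [u uS uleaf] := acyclic_leaf e_irr e_sym e_acyclic S0.
have card1 w S' : w \in S' -> #|S'| = #|S' :\ w|.+1 by move=> wS; rewrite (cardsD1 w) wS.
have Su : (#|S :\ u| <= n)%N by rewrite -ltnS -card1.
have [/forall_inP iu|] := boolP [forall v in S, ~~ e u v].
  have [a [z [b [abz ind]]]] := IH _ c Su.
  have [a' [z' [b' [abz' ind']]]] := isolated_inertia uS iu ind.
  by exists a', z', b'; split=> //; rewrite abz' abz -card1.
rewrite negb_forall_in => /exists_inP[v vS /negbNE uv].
have uniq_v : {in S, forall w, e u w -> w = v}.
  by move=> w wS uw; apply: uleaf.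
have [t tE] := phi_p_surj (c u / W u v) p1.
have Wuv : W u v != 0 by rewrite gt_eqF // W_gt0.
have [t1|t1] := eqVneq (1 + t) 0; last first.
  have cu : c u = W u v * phi_p p t by rewrite tE mulrC divfK.
  have [a [z [b [abz ind]]]] := IH (S :\ u)
    (fun w => c w + (w == v)%:R * (W u v * phi_p p (t / (1 + t)))) Su.
  have [a' [z' [b' [abz' ind']]]] := leaf_inertia uS vS uv uniq_v t1 cu ind.
  by exists a', z', b'; split=> //; rewrite abz' abz -card1.
have cu : c u = - W u v.
  have tN : t = -1 by lra.
  by move: tE; rewrite tN phi_pN phi_p1 => tE; rewrite -[c u](divfK Wuv) -tE mulN1r.
have uv' : u != v by apply: contraTneq uv => ->; rewrite e_irr.
have uSv : u \in S :\ v by rewrite !inE uv'.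
have Svu : (#|S :\ v :\ u| <= n)%N.
  by rewrite -ltnS -card1 //; apply: leq_trans Sn; rewrite (card1 _ _ vS) leqnSn.
have [a [z [b [abz ind]]]] := IH (S :\ v :\ u) (fun w => c w + W v w) Svu.
exists a.+1, z, b.+1; split; last exact: singular_leaf_inertia ind.
by rewrite (card1 _ _ vS) (card1 _ _ uSv) -abz addnS !addSn.
Qed.

End EnergyInertia.

(** * The genus on the p-sphere *)

Section Topology.
Variable R : realType.

Lemma continuous_into_product (T : topologicalType) (V : finType) (g : T -> V -> R) :
  (forall u, continuous (fun x => g x u)) -> continuous g.
Proof.
move=> gc x; apply/cvg_sup => u.
move: x; apply/(@continuousP T (initial_topology (@^~ u))) => A [B oB <-].
have -> : g @^-1` ((@^~ u) @^-1` B) = (fun x => g x u) @^-1` B by [].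
by apply: open_comp => // x _; exact: gc.
Qed.

Lemma cvg_into_row (T : Type) (F : set_system T) {FF : Filter F} n
    (g : T -> 'rV[R]_n) (y : 'rV[R]_n) :
  (forall j, g x 0 j @[x --> F] --> y 0 j) -> g @ F --> y.
Proof.
move=> gc U [P Py PU].
apply: (@filterS _ F _ (fun x => forall j, P 0 j (g x 0 j))).
  by move=> x Px; apply: PU => i j; rewrite ord1; exact: Px.
apply: filter_forall => j.
by have := gc j; apply; exact: Py.
Qed.

End Topology.

Section PSphere.
Variables (R : realType) (V : finType) (p : R).
Hypothesis p1 : 1 < p.
Let p0 : 0 < p. Proof. exact: lt_trans p1. Qed.
Implicit Types (f : V -> R).

Definition mass (f : V -> R) := \sum_u `|f u| `^ p.

Lemma mass_ge0 f : 0 <= mass f. Proof. by apply: sumr_ge0 => u _; exact: powR_ge0. Qed.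

Lemma mass_eq0 f : mass f = 0 -> f = 0.
Proof.
move=> /eqP; rewrite psumr_eq0; last by move=> u _; exact: powR_ge0.
move=> /allP f0; apply/funext => u.
by have := f0 u (mem_index_enum _) => /=; rewrite powR_eq0 normr_eq0 => /andP[/eqP].
Qed.

Lemma mass_gt0 f : f <> 0 -> 0 < mass f.
Proof.
move=> f0; rewrite lt_neqAle mass_ge0 andbT eq_sym.
by apply/eqP => /mass_eq0.
Qed.

Lemma continuous_coord_powR u : continuous (fun f => `|f u| `^ p).
Proof.
apply: (@continuous_fun_comp _ _ (fun x => `|x| `^ p)); last exact: coord_fun_continuous.
exact: continuous_norm_powR.
Qed.

Lemma continuous_mass : continuous mass.
Proof. by apply: continuous_fun_sum => u; exact: continuous_coord_powR. Qed.

Lemma p_normE f : p_norm p f = `|mass f| `^ p^-1.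
Proof. by rewrite ger0_norm ?mass_ge0. Qed.

Lemma continuous_p_norm : continuous (p_norm p : (V -> R) -> R).
Proof.
rewrite (_ : p_norm p = fun f => `|mass f| `^ p^-1); last by apply/funext => f; rewrite p_normE.
apply: (@continuous_fun_comp _ _ (fun x => `|x| `^ p^-1)); last exact: continuous_mass.
by apply: continuous_norm_powR; rewrite invr_gt0.
Qed.

Lemma p_sphereE f : p_sphere p f <-> mass f = 1.
Proof.
rewrite /p_sphere /= p_normE; split=> [fE|->]; last by rewrite normr1 powR1.
have : (`|mass f| `^ p^-1) `^ p = 1 by rewrite fE powR1.
by rewrite -powRrM mulVf ?gt_eqF // powRr1 // ger0_norm // mass_ge0.
Qed.

Lemma p_sphere_neq0 f : p_sphere p f -> f <> 0.
Proof.
move=> /p_sphereE + f0; rewrite f0 /mass big1; first by move/esym/eqP; rewrite oner_eq0.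
by move=> u _; rewrite normr0 powR0 // gt_eqF.
Qed.

Lemma p_sphereN f : p_sphere p f -> p_sphere p (- f).
Proof.
rewrite !p_sphereE => <-; apply: eq_bigr => u _.
by rewrite coord_odd normrN.
Qed.

Lemma p_sphere_coord f u : p_sphere p f -> `|f u| <= 1.
Proof.
move=> /p_sphereE f1; rewrite leNgt; apply/negP => fu.
have : 1 < `|f u| `^ p.
  rewrite -[ltLHS](congr1 (@^~ p) (powR1 R)).
  by apply: gt0_ltr_powR; rewrite ?nnegrE.
by rewrite ltNge -f1 /mass (bigD1 u) //= lerDl sumr_ge0.
Qed.

Lemma p_sphere_closed : closed (p_sphere p : set (V -> R)).
Proof.
have -> : p_sphere p = p_norm p @^-1` [set (1 : R)] :> set (V -> R) by [].
apply: preimage_closed; last exact: closed_eq.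
by move=> f _; exact: continuous_p_norm.
Qed.

Lemma p_sphere_compact : compact (p_sphere p : set (V -> R)).
Proof.
apply: (subclosed_compact p_sphere_closed (@tychonoff V (fun=> R) (fun=> `[-1, 1]%classic) _)).
  by move=> _; exact: segment_compact.
by move=> f fS u /=; rewrite in_itv /= -ler_norml p_sphere_coord.
Qed.

Definition normalize f : V -> R := fun u => (p_norm p f)^-1 * f u.

Lemma p_norm_gt0 f : f <> 0 -> 0 < p_norm p f.
Proof. by move=> f0; rewrite powR_gt0 // mass_gt0. Qed.

Lemma normalize_sphere f : f <> 0 -> p_sphere p (normalize f).
Proof.
move=> f0; apply/p_sphereE; have m0 := mass_gt0 f0.
have -> : mass (normalize f) = `|(p_norm p f)^-1| `^ p * mass f.
  rewrite /mass mulr_sumr; apply: eq_bigr => u _.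
  by rewrite /normalize normrM powRM.
rewrite gtr0_norm ?invr_gt0 ?p_norm_gt0 // p_normE gtr0_norm //.
by rewrite -powRN -powRrM mulNr mulVf ?gt_eqF // powRN powRr1 ?mulVf ?gt_eqF // ltW.
Qed.

Definition zero_locus (hs : seq (oddfun R V)) := [set f | p_sphere p f /\ vanish hs f].

Lemma zero_locus_closed hs : closed (zero_locus hs).
Proof.
have -> : zero_locus hs = p_sphere p `&` [set f | vanish hs f] by [].
apply: closedI; first exact: p_sphere_closed.
elim: hs => [|h hs IH].
  by rewrite (_ : [set _ | _] = setT); [exact: closedT|apply/seteqP].
rewrite (_ : [set _ | _] = h @^-1` [set (0 : R)] `&` [set f | vanish hs f]).
  apply: closedI => //; apply: preimage_closed; last exact: closed_eq.
  by move=> f _; exact: oddfun_continuous.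
by apply/seteqP; split=> f /=; [move=> /andP[/eqP ? ?]|move=> [-> ->]; rewrite eqxx].
Qed.

Lemma vanishN (hs : seq (oddfun R V)) f : vanish hs (- f) = vanish hs f.
Proof. by apply: eq_all => h; rewrite /= oddfunN oppr_eq0. Qed.

Lemma zero_locus_sym hs : symmetric_set (zero_locus hs).
Proof.
apply/seteqP; split=> [_ [f [fS fv] <-]|f [fS fv]].
  by split; [exact: p_sphereN|rewrite vanishN].
exists (- f); last by rewrite opprK.
by split; [exact: p_sphereN|rewrite vanishN].
Qed.

Lemma zero_locus_compact hs : compact (zero_locus hs).
Proof.
by apply: (subclosed_compact (@zero_locus_closed hs) p_sphere_compact) => f [].
Qed.

Definition nth_value (hs : seq (oddfun R V)) j f :=
  nth 0 [seq (h : oddfun R V) f | h <- hs] j.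

Lemma continuous_nth_value hs j : continuous (nth_value hs j).
Proof.
rewrite /nth_value; elim: hs j => [|h s IH] [|j] /=.
- exact: cst_continuous.
- exact: cst_continuous.
- exact: oddfun_continuous.
- exact: IH.
Qed.

Lemma nth_valueN hs j f : nth_value hs j (- f) = - nth_value hs j f.
Proof.
by rewrite /nth_value; elim: hs j => [|h s IH] [|j] /=; rewrite ?oppr0 ?oddfunN ?IH.
Qed.

Lemma nth_value_vanish hs f :
  (forall j, (j < size hs)%N -> nth_value hs j f = 0) -> vanish hs f.
Proof.
move=> f0; suff : all (fun x => x == 0) [seq (g : oddfun R V) f | g <- hs] by rewrite all_map.
by apply/(all_nthP 0) => j; rewrite size_map => /f0/eqP.
Qed.

Lemma genus_le_codim (A : set (V -> R)) (hs : seq (oddfun R V)) :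
  (forall f, A f -> ~~ vanish hs f) -> (genus A <= (size hs)%:R%:E)%E.
Proof.
move=> Ahs; apply: ereal_inf_lbound; exists (size hs) => //.
exists (fun f => \row_(j < size hs) nth_value hs j f); split.
- apply: continuous_subspaceT => f.
  apply: (@cvg_into_row _ _ (nbhs f)) => j.
  rewrite mxE; under eq_cvg do rewrite mxE.
  exact: continuous_nth_value.
- by move=> f _; apply/rowP => j; rewrite !mxE nth_valueN.
- move=> f /Ahs; apply: contra => /eqP/rowP f0; apply: nth_value_vanish => j js.
  by have := f0 (Ordinal js); rewrite !mxE.
Qed.

End PSphere.

Section GenusLowerBound.
Variables (R : realType) (V : finType) (p : R).
Hypothesis p1 : 1 < p.
Let p0 : 0 < p. Proof. exact: lt_trans p1. Qed.
Local Notation E := 'rV[R]_#|V|.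

Definition fun_of_row (x : E) : V -> R := fun u => x 0 (enum_rank u).

Lemma continuous_fun_of_row : continuous fun_of_row.
Proof. by apply: continuous_into_product => u; exact: coord_continuous. Qed.

Lemma fun_of_rowN x : fun_of_row (- x) = - fun_of_row x.
Proof. by apply/funext => u; rewrite /fun_of_row mxE. Qed.

Lemma fun_of_row_neq0 x : x != 0 -> fun_of_row x <> 0.
Proof.
move=> x0 fx0; move/eqP: x0; apply; apply/rowP => j.
by have := congr1 (@^~ (enum_val j)) fx0; rewrite /fun_of_row enum_valK mxE.
Qed.

Lemma p_normN (f : V -> R) : p_norm p (- f) = p_norm p f.
Proof.
rewrite /p_norm; congr powR.
by apply: eq_bigr => u _; rewrite coord_odd normrN.
Qed.

Definition row_normalize (x : E) : E := (p_norm p (fun_of_row x))^-1 *: x.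

Lemma row_normalizeE x : fun_of_row (row_normalize x) = normalize p (fun_of_row x).
Proof. by apply/funext => u; rewrite /fun_of_row mxE. Qed.

Lemma row_normalizeN x : row_normalize (- x) = - row_normalize x.
Proof.
by rewrite /row_normalize fun_of_rowN p_normN scalerN.
Qed.

Lemma continuous_row_normalize x : x != 0 -> {for x, continuous row_normalize}.
Proof.
move=> x0; have n0 := p_norm_gt0 p (fun_of_row_neq0 x0).
apply: (@cvg_into_row _ _ (nbhs x)) => j.
under eq_cvg do rewrite mxE.
rewrite mxE; apply: (@cvgM _ _ (nbhs x)); last exact: coord_continuous.
apply: (@cvgV _ _ (nbhs x)); first by rewrite gt_eqF.
apply: (@cvg_comp _ _ _ fun_of_row (p_norm p) _ (nbhs (fun_of_row x))).
  exact: continuous_fun_of_row.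
exact: continuous_p_norm.
Qed.

Lemma odd_extension (hs : seq (oddfun R V)) (phi : (V -> R) -> R) :
  {within zero_locus p hs, continuous phi} ->
  (forall f, zero_locus p hs f -> phi (- f) = - phi f) ->
  exists g : E -> R, [/\ continuous g, forall x, g (- x) = - g x &
    forall x, zero_locus p hs (fun_of_row x) -> g x = phi (fun_of_row x)].
Proof.
move=> phic phiN; set A := zero_locus p hs.
pose B : set E := fun_of_row @^-1` A.
have Bcl : closed B.
  apply: preimage_closed; last exact: zero_locus_closed.
  by move=> x _; exact: continuous_fun_of_row.
have Bco : compact B.
  apply: bounded_closed_compact => //; exists 1; split; first exact: num_real.
  move=> M M1 x [Sx _]; apply: le_trans (ltW M1).
  rewrite [leLHS]/Num.norm /= mx_normrE; apply: bigmax_le => // -[i j] _ /=.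
  have := p_sphere_coord p1 (enum_val j) Sx.
  by rewrite /fun_of_row enum_valK (ord1 i).
have phicB : {within B, continuous (phi \o fun_of_row)}.
  apply/subspace_continuousP => x Bx.
  move/subspace_continuousP : phic => /(_ _ Bx) phic U /phic.
  by move=> AU; exact: continuous_fun_of_row AU.
have [M M0 BM] : exists2 M, 0 < M & forall x, B x -> `|phi (fun_of_row x)| <= M.
  have [B0|/set0P B0] := eqVneq B set0.
    by exists 1 => // x; rewrite B0.
  have [] := @compact_EVT_max E R (fun x => `|phi (fun_of_row x)|) B B0 Bco.
    by move=> x; apply: cvg_norm; exact: phicB.
  move=> x _ xmax; exists (1 + `|phi (fun_of_row x)|); first by rewrite ltr_pwDl.
  by move=> y By; rewrite ler_wpDl // xmax // inE.
have [g [gE gc _]] := continuous_bounded_extension pseudometric_normal Bcl M0 phicB BM.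
(* the odd part of a Tietze extension *)
exists (fun x => 2^-1 * (g x - g (- x))); split.
- apply: continuous_funZ; apply: continuous_funB => //.
  move=> x; apply: (@cvg_comp _ _ _ -%R g _ (nbhs (- x))); last exact: gc.
  exact: opp_continuous.
- by move=> x; rewrite opprK -mulrN opprB.
- move=> x Ax; have BNx : B (- x).
    rewrite /B /= fun_of_rowN; have [Sx vx] := Ax.
    by split; [exact: p_sphereN|rewrite vanishN].
  rewrite -!gE ?inE //= fun_of_rowN phiN // opprK; by field.
Qed.

(** Given a nonvanishing odd map of the locus into dimension [m < k], extend its
    coordinates by Tietze's theorem and make them odd.  Together with [hs] these
    are fewer odd functions than the dimension, so they have a common zero on the
    sphere: it lies in the locus, where the map was nonzero. *)
Lemma genus_ge_codim (hs : seq (oddfun R V)) k : (size hs + k <= #|V|)%N ->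
  (k%:R%:E <= genus (zero_locus p hs))%E.
Proof.
move=> hk; apply: le_ereal_inf_tmp => _ [m [phi [phic phiN phi0]] <-].
rewrite lee_fin ler_nat leqNgt; apply/negP => mk.
have /choice[g gP] : forall i : 'I_m, exists g : E -> R, [/\ continuous g,
    forall x, g (- x) = - g x &
    forall x, zero_locus p hs (fun_of_row x) -> g x = phi (fun_of_row x) 0 i].
  move=> i; apply: (@odd_extension hs (fun f => phi f 0 i)).
    move=> f; apply: (@cvg_comp _ _ _ phi (fun y : 'rV[R]_m => y 0 i) _ (nbhs (phi f))).
      exact: phic.
    exact: coord_continuous.
  by move=> f Af; rewrite phiN // mxE.
pose G i x := if insub i is Some j then g j (row_normalize x)
  else nth_value hs (i - m)%N (fun_of_row (row_normalize x)).
have [||| x [Kx Gx]] := @borsuk_ulam R #|V| (m + size hs) G.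
- by apply: leq_trans hk; rewrite addnC -addnS leq_add2l.
- move=> i x x0; rewrite /G; case: insubP => [j _ _|_].
    apply: (@cvg_comp _ _ _ row_normalize (g j) _ (nbhs (row_normalize x))).
      exact: continuous_row_normalize.
    by have [gc _ _] := gP j; exact: gc.
  apply: (@cvg_comp _ _ _ row_normalize
    (nth_value hs (i - m)%N \o fun_of_row) _ (nbhs (row_normalize x))).
    exact: continuous_row_normalize.
  apply: continuous_comp; first exact: continuous_fun_of_row.
  exact: continuous_nth_value.
- move=> i x; rewrite /G row_normalizeN; case: insubP => [j _ _|_].
    by have [_ gN _] := gP j; rewrite gN.
  by rewrite fun_of_rowN nth_valueN.
have x0 := octahedron_neq0 Kx.
set y := row_normalize x.
have Sy : p_sphere p (fun_of_row y).
  by rewrite row_normalizeE; exact: normalize_sphere (fun_of_row_neq0 x0).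
have Ay : zero_locus p hs (fun_of_row y).
  split=> //; apply: nth_value_vanish => j js.
  have := Gx (m + j)%N; rewrite ltn_add2l js => /(_ isT).
  by rewrite /G insubN -?leqNgt ?leq_addr // addKn.
have /negP[] := phi0 _ Ay; apply/eqP/rowP => i; rewrite mxE.
have := Gx i (ltn_addr _ (ltn_ord i)); rewrite /G valK.
by have [_ _ <-] := gP i.
Qed.

End GenusLowerBound.

(** * Variational eigenvalues from an inertia *)

Section Rayleigh.
Variables (R : realType) (V : finType) (G : wgraph R V) (kappa : V -> R) (p lambda : R).
Hypothesis p1 : 1 < p.
Let p0 : 0 < p. Proof. exact: lt_trans p1. Qed.
Implicit Types (f : V -> R).

Definition rayleigh_den f := \sum_u node_weight G u * `|f u| `^ p.

Definition rayleigh_num f :=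
  (\sum_u \sum_(v | adj G u v) edge_weight G u v * `|f u - f v| `^ p) / 2
   + \sum_u kappa u * `|f u| `^ p.

(** Its sign compares the Rayleigh quotient with [lambda]. *)
Definition level f := rayleigh_num f - lambda * rayleigh_den f.

Lemma rayleigh_den_gt0 f : f <> 0 -> 0 < rayleigh_den f.
Proof.
move=> f0; rewrite lt_neqAle sumr_ge0 ?andbT; last first.
  by move=> u _; rewrite mulr_ge0 ?powR_ge0 // ltW // node_weight_gt0.
rewrite eq_sym psumr_eq0; last first.
  by move=> u _; rewrite mulr_ge0 ?powR_ge0 // ltW // node_weight_gt0.
apply/negP => /allP d0; apply: f0; apply/funext => u.
have := d0 u (mem_index_enum _); rewrite /= mulf_eq0 gt_eqF ?node_weight_gt0 //=.
by rewrite powR_eq0 normr_eq0 => /andP[/eqP].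
Qed.

Lemma rayleighE f : f <> 0 -> rayleigh G kappa p f = lambda + level f / rayleigh_den f.
Proof.
move=> f0; rewrite /rayleigh -/(rayleigh_num f) -/(rayleigh_den f) /level.
by field; rewrite gt_eqF // rayleigh_den_gt0.
Qed.

Lemma continuous_rayleigh f : f <> 0 -> {for f, continuous (rayleigh G kappa p)}.
Proof.
move=> f0.
have cnum : continuous rayleigh_num.
  apply: continuous_funD.
    rewrite (_ : (fun x => _) = fun f => 2^-1 *
      \sum_u \sum_(v | adj G u v) edge_weight G u v * `|f u - f v| `^ p); last first.
      by apply/funext => g; rewrite mulrC.
    apply: continuous_funZ; apply: continuous_fun_sum => u.
    apply: continuous_fun_sum => v; apply: continuous_funZ.
    apply: (@continuous_fun_comp _ _ (fun x => `|x| `^ p)); first exact: continuous_norm_powR.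
    by apply: continuous_funB; exact: coord_fun_continuous.
  by apply: continuous_fun_sum => u; apply: continuous_funZ; exact: continuous_coord_powR.
have cden : continuous rayleigh_den.
  by apply: continuous_fun_sum => u; apply: continuous_funZ; exact: continuous_coord_powR.
apply: (@cvgM _ _ (nbhs f)); first exact: cnum.
apply: (@cvgV _ _ (nbhs f)); last exact: cden.
by rewrite gt_eqF // rayleigh_den_gt0.
Qed.

Lemma genus_mono (A B : set (V -> R)) : A `<=` B -> (genus A <= genus B)%E.
Proof.
move=> AB; apply: ereal_inf_le_tmp => _ [m [phi [phic phiN phi0]] <-].
exists m => //; exists phi; split.
- by apply: continuous_subspaceW phic.
- by move=> f /AB/phiN.
- by move=> f /AB/phi0.
Qed.

Lemma family_meets k (A : set (V -> R)) (hs : seq (oddfun R V)) :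
  genus_family p k A -> (size hs < k)%N -> exists f, A f /\ zero_locus p hs f.
Proof.
move=> [AS _ _ kA] hk; apply: contrapT => no.
have : (genus A <= (size hs)%:R%:E)%E.
  apply: genus_le_codim => f Af; apply/negP => fv; apply: no; exists f.
  by split=> //; split=> //; exact: AS.
by move=> /(le_trans kA); rewrite lee_fin ler_nat leqNgt hk.
Qed.

Lemma zero_locus_family k (hs : seq (oddfun R V)) : (size hs + k <= #|V|)%N ->
  genus_family p k (zero_locus p hs).
Proof.
move=> hk; split.
- by move=> f [].
- exact: zero_locus_sym.
- exact: zero_locus_closed.
- exact: genus_ge_codim.
Qed.

(** Compactness turns the strict inequality into a gap, which survives the infimum
    over all sets of a given genus. *)
Lemma zero_locus_rayleigh_gt (hs : seq (oddfun R V)) :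
  (forall f, vanish hs f -> 0 < level f \/ f = 0) ->
  exists2 m, lambda < m & forall f, zero_locus p hs f -> m <= rayleigh G kappa p f.
Proof.
move=> hP; have [K0|/set0P K0] := eqVneq (zero_locus p hs) set0.
  by exists (lambda + 1); rewrite ?ltrDl // => f; rewrite K0.
have [|f] := @compact_EVT_min _ R (rayleigh G kappa p) _ K0 (zero_locus_compact p1 (hs := hs)).
  apply: continuous_in_subspaceT => f; rewrite inE => -[fS _].
  exact: continuous_rayleigh (p_sphere_neq0 p1 fS).
rewrite inE => -[fS fv] fmin; have f0 := p_sphere_neq0 p1 fS.
exists (rayleigh G kappa p f); last by move=> g gK; apply: fmin; rewrite inE.
by rewrite rayleighE // ltrDl divr_gt0 ?rayleigh_den_gt0 //; have [|/f0] := hP f fv.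
Qed.

Lemma zero_locus_rayleigh_lt (hs : seq (oddfun R V)) :
  (forall f, vanish hs f -> level f < 0 \/ f = 0) ->
  exists2 m, m < lambda & forall f, zero_locus p hs f -> rayleigh G kappa p f <= m.
Proof.
move=> hP; have [K0|/set0P K0] := eqVneq (zero_locus p hs) set0.
  by exists (lambda - 1); rewrite ?gtrBl // => f; rewrite K0.
have [|f] := @compact_EVT_max _ R (rayleigh G kappa p) _ K0 (zero_locus_compact p1 (hs := hs)).
  apply: continuous_in_subspaceT => f; rewrite inE => -[fS _].
  exact: continuous_rayleigh (p_sphere_neq0 p1 fS).
rewrite inE => -[fS fv] fmax; have f0 := p_sphere_neq0 p1 fS.
exists (rayleigh G kappa p f); last by move=> g gK; apply: fmax; rewrite inE.
rewrite rayleighE // gtrDl pmulr_llt0 ?invr_gt0 ?rayleigh_den_gt0 //.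
by have [|/f0] := hP f fv.
Qed.

Section FromInertia.
Variables (a z b : nat).
Hypothesis abz : (a + z + b)%N = #|V|.
Hypothesis ind : inertia level (eigen_equation G kappa p lambda) (fun f => f = 0) a z b.

Lemma variational_ge k : (a < k)%N -> (lambda%:E <= variational_value G kappa p k)%E.
Proof.
move=> ak; have [hs sz hP] := inertia_ge0 ind.
apply: le_ereal_inf_tmp => _ [A fam <-].
have [|f [Af [fS fv]]] := family_meets (hs := hs) fam; first by rewrite sz.
have f0 := p_sphere_neq0 p1 fS.
apply: le_ereal_sup_tmp; exists (rayleigh G kappa p f)%:E; first by exists f.
by rewrite lee_fin rayleighE // lerDl divr_ge0 ?hP // ltW // rayleigh_den_gt0.
Qed.

Lemma variational_le k : (k <= a + z)%N -> (variational_value G kappa p k <= lambda%:E)%E.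
Proof.
move=> kaz; have [hs sz hP] := inertia_le0 ind.
apply: ge_ereal_inf; eexists.
  exists (zero_locus p hs) => //; apply: zero_locus_family.
  by rewrite sz -abz addnC leq_add2r.
apply: ge_ereal_sup => _ [f [fS fv] <-]; have f0 := p_sphere_neq0 p1 fS.
by rewrite lee_fin rayleighE // gerDl pmulr_lle0 ?hP // invr_gt0 rayleigh_den_gt0.
Qed.

Lemma variational_gt k : (a + z < k)%N -> (lambda%:E < variational_value G kappa p k)%E.
Proof.
move=> azk; have [hs sz hP] := inertia_gt0 ind.
have [m lm mP] := zero_locus_rayleigh_gt hP.
apply: (@lt_le_trans _ _ m%:E); first by rewrite lte_fin.
apply: le_ereal_inf_tmp => _ [A fam <-].
have [|f [Af fK]] := family_meets (hs := hs) fam; first by rewrite sz.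
apply: le_ereal_sup_tmp; exists (rayleigh G kappa p f)%:E; first by exists f.
by rewrite lee_fin mP.
Qed.

Lemma variational_lt k : (k <= a)%N -> (variational_value G kappa p k < lambda%:E)%E.
Proof.
move=> ka; have [hs sz hP] := inertia_lt0 ind.
have [m lm mP] := zero_locus_rayleigh_lt hP.
apply: (@le_lt_trans _ _ m%:E); last by rewrite lte_fin.
apply: ge_ereal_inf; eexists.
  exists (zero_locus p hs) => //; apply: zero_locus_family.
  by rewrite sz -abz; lia.
by apply: ge_ereal_sup => _ [f fK <-]; rewrite lee_fin mP.
Qed.

Lemma variational_value_eq k :
  (variational_value G kappa p k == lambda%:E) = (a < k <= a + z)%N.
Proof.
apply/eqP/andP => [vk|[ak kaz]].
  split; [rewrite ltnNge|rewrite leqNgt]; apply/negP.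
    by move=> /variational_lt; rewrite vk ltxx.
  by move=> /variational_gt; rewrite vk ltxx.
by apply/eqP; rewrite eq_le variational_le // variational_ge.
Qed.

Lemma variational_mult_inertia : variational_mult G kappa p lambda = z.
Proof.
rewrite /variational_mult -sum1_card.
under eq_bigl do rewrite inE variational_value_eq.
rewrite -(big_mkord (fun i => (a < i.+1 <= a + z)%N) (fun=> 1%N)) -abz.
rewrite (big_cat_nat (leq0n a)) /=; last by lia.
rewrite [X in (_ + X)%N](big_cat_nat (n := a + z)) /=; [|by lia|by lia].
rewrite big_nat_cond big1; last by move=> i; lia.
rewrite [X in (_ + (_ + X))%N]big_nat_cond [X in (_ + (_ + X))%N]big1; last by move=> i; lia.
rewrite add0n addn0 -[RHS](addKn a) -[RHS]muln1 -sum_nat_const_nat.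
by rewrite big_nat_cond [RHS]big_nat_cond; apply: eq_bigl => i; lia.
Qed.

Lemma genus_mult_inertia : genus_mult G kappa p lambda = z%:R%:E.
Proof.
apply/eqP; rewrite eq_le; apply/andP; split.
  have [hs <- hP] := inertia_eig0 ind.
  apply: genus_le_codim => f [fS ef]; apply/negP => /hP/(_ ef).
  exact: p_sphere_neq0 fS.
have [hs sz hP] := inertia_eig ind.
apply: le_trans (genus_mono (_ : zero_locus p hs `<=` _)).
  by apply: genus_ge_codim => //; rewrite sz -abz; lia.
by move=> f [fS fv]; split=> //; exact: hP.
Qed.

Lemma eigenvalue_inertia : is_eigenvalue G kappa p lambda <-> (0 < z)%N.
Proof.
split=> [[f [f0 ef]]|z0].
  have [hs sz hP] := inertia_eig0 ind; rewrite lt0n -sz.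
  by apply: contra_notN f0 => /nilP hs0; apply: hP; rewrite ?hs0.
apply: contrapT => noeig; have := genus_mult_inertia.
have : (genus_mult G kappa p lambda <= 0%:R%:E)%E.
  apply: (@genus_le_codim _ _ _ [::]) => f [fS ef]; exfalso; apply: noeig.
  by exists f; split=> //; exact: p_sphere_neq0 fS.
by move=> + gz; rewrite gz lee_fin ler_nat leqNgt z0.
Qed.

End FromInertia.

Lemma graph_inertia : graph_acyclic G -> exists abz : nat * nat * nat,
  (abz.1.1 + abz.1.2 + abz.2)%N = #|V| /\
  inertia level (eigen_equation G kappa p lambda) (fun f => f = 0)
    abz.1.1 abz.1.2 abz.2.
Proof.
move=> acyc.
pose S : {set V} := [set: V]%SET.
pose W u v := if adj G u v then edge_weight G u v else 0.
have W0 u v : adj G u v -> 0 < W u v by move=> uv; rewrite /W uv edge_weight_gt0.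
have W1 u v : ~~ adj G u v -> W u v = 0 by move=> /negbTE uv; rewrite /W uv.
have W2 u v : W u v = W v u.
  by rewrite /W adj_sym; case: ifP => // vu; rewrite edge_weight_sym // adj_sym.
have sumT (F : V -> R) : \sum_(v in S) F v = \sum_v F v.
  by apply: eq_bigl => v; rewrite inE.
have sumW (F : V -> R) u :
    \sum_(v in S) W u v * F v = \sum_(v | adj G u v) edge_weight G u v * F v.
  rewrite sumT [RHS]big_mkcond; apply: eq_bigr => v _.
  by rewrite /W; case: ifP; rewrite ?mul0r.
have [a [z [b [abz ind]]]] := acyclic_inertia p1 (adj_irrefl G) (adj_sym G)
  acyc W0 W1 W2 S (fun u => kappa u - lambda * node_weight G u).
exists (a, z, b); rewrite /= abz /S cardsT; split=> //.
have -> : level = energy p W S (fun u => kappa u - lambda * node_weight G u).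
  apply/funext => f; rewrite /level /rayleigh_num /energy -addrA; congr (_ / 2 + _).
    by rewrite sumT; apply: eq_bigr => u _; rewrite sumW.
  rewrite /rayleigh_den mulr_sumr -sumrB sumT; apply: eq_bigr => u _; ring.
have -> : eigen_equation G kappa p lambda =
    critical p W S (fun u => kappa u - lambda * node_weight G u).
  have gE f u : gradient p W S (fun u => kappa u - lambda * node_weight G u) f u =
      p_laplacian G kappa p f u - lambda * node_weight G u * phi_p p (f u).
    by rewrite /gradient /p_laplacian sumW; ring.
  apply/funext => f; apply/propext; split=> [ef u _|cf u].
    by rewrite gE ef subrr.
  by have /eqP := cf u (finset.in_setT u); rewrite gE subr_eq0 => /eqP.
have <- // : null_on S = fun f : V -> R => f = 0.
apply/funext => f; apply/propext; split=> [f0|-> //].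
by apply/funext => u; exact: f0.
Qed.

End Rayleigh.

(** * Forests *)

Section Forest.
Variables (R : realType) (V : finType) (G : wgraph R V) (kappa : V -> R) (p lambda : R).
Variables (k : nat) (T : 'I_k -> {set V}).
Hypothesis p1 : 1 < p.
Hypothesis forest : forest_decomposition G T.
Local Notation H i := (induced_subgraph G (T i)).
Local Notation restrict i := (@restrict_fun V (T i) R).

Lemma sum_over_trees (M : nmodType) (F : V -> M) :
  \sum_u F u = \sum_i \sum_(w : {v : V | v \in T i}) F (val w).
Proof.
have [Tuniq _ _] := forest.
have /choice[idx idxP] : forall v, exists i, v \in T i /\ forall j, v \in T j -> i = j.
  by move=> v; have [i] := Tuniq v; exists i.
rewrite (partition_big idx predT) //=; apply: eq_bigr => i _.
rewrite -(big_sub (T i)) /=; apply: eq_bigl => v.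
by apply/eqP/idP => [<-|/(idxP v).2 //]; exact: (idxP v).1.
Qed.

Lemma sum_neighbours (M : nmodType) (F : V -> M) i (w : {v : V | v \in T i}) :
  \sum_(v | adj G (val w) v) F v = \sum_(x | adj (H i) w x) F (val x).
Proof.
have [_ Tadj _] := forest.
rewrite -(big_sub_cond (T i) (adj G (val w))); apply: eq_bigl => v.
by have [wv|] := boolP (adj G (val w) v); rewrite ?andbF // (Tadj _ _ _ wv) // (valP w).
Qed.

Lemma card_trees : #|V| = (\sum_i #|{: {v : V | v \in T i}}|)%N.
Proof.
rewrite -sum1_card (sum_over_trees (fun=> 1%N)).
by apply: eq_bigr => i _; rewrite sum1_card.
Qed.

Lemma level_trees f :
  level G kappa p lambda f = \sum_i level (H i) (restrict i kappa) p lambda (restrict i f).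
Proof.
rewrite /level /rayleigh_num /rayleigh_den sumrB big_split /= -mulr_suml -mulr_sumr.
rewrite !sum_over_trees; congr (_ / 2 + _ - _).
apply: eq_bigr => i _; apply: eq_bigr => w _; exact: sum_neighbours.
Qed.

Lemma eigen_trees f : eigen_equation G kappa p lambda f <->
  forall i, eigen_equation (H i) (restrict i kappa) p lambda (restrict i f).
Proof.
have lapE i (w : {v : V | v \in T i}) :
    p_laplacian G kappa p f (val w) = p_laplacian (H i) (restrict i kappa) p (restrict i f) w.
  by rewrite /p_laplacian sum_neighbours.
split=> [ef i w|ef u]; first by rewrite -lapE ef.
have [Tuniq _ _] := forest; have [i [ui _]] := Tuniq u.
by have := ef i (exist _ u ui); rewrite -lapE.
Qed.

Lemma null_trees (f : V -> R) : f = 0 <-> forall i, restrict i f = 0.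
Proof.
split=> [-> i|f0]; first exact/funext.
apply/funext => u; have [Tuniq _ _] := forest; have [i [ui _]] := Tuniq u.
exact: (congr1 (@^~ (exist _ u ui)) (f0 i)).
Qed.

Lemma forest_inertia (a z b : 'I_k -> nat) :
  (forall i, inertia (level (H i) (restrict i kappa) p lambda)
    (eigen_equation (H i) (restrict i kappa) p lambda) (fun f => f = 0) (a i) (z i) (b i)) ->
  inertia (level G kappa p lambda) (eigen_equation G kappa p lambda) (fun f => f = 0)
    (\sum_i a i) (\sum_i z i) (\sum_i b i).
Proof.
move=> ind.
have codim (n : 'I_k -> nat) (P : forall i, ({v : V | v \in T i} -> R) -> Prop) :
    (forall i, odd_codim (n i) (P i)) ->
    odd_codim (\sum_i n i) (fun f => forall i, P i (restrict i f)).
  move=> nP; apply: (odd_codim_family (P := fun i f => P i (restrict i f))) => i.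
  have ec : continuous (restrict i).
    by apply: continuous_into_product => w; exact: coord_fun_continuous.
  exact: (odd_codim_comp ec (fun=> erefl) (nP i)).
have p0 : 0 < p by exact: lt_trans p1.
have lev0 i (f : {v : V | v \in T i} -> R) : f = 0 ->
    level (H i) (restrict i kappa) p lambda f = 0.
  move=> ->; rewrite /level /rayleigh_num /rayleigh_den.
  have z0 : `|0 : R| `^ p = 0 by rewrite normr0 powR0 // gt_eqF.
  rewrite !big1 ?mul0r ?mulr0 ?addr0 ?subr0 // => u _; rewrite ?z0 ?mulr0 //.
  by rewrite big1 // => v _; rewrite subr0 z0 mulr0.
split.
- apply: odd_codimW (codim _ _ (fun i => inertia_ge0 (ind i))) _ => f fP.
  by rewrite level_trees sumr_ge0.
- rewrite -big_split; apply: odd_codimW (codim _ _ (fun i => inertia_gt0 (ind i))) _ => f fP.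
  have [f0|/existsNP[i fi]] := pselect (forall i, restrict i f = 0).
    by right; apply/null_trees.
  left; rewrite level_trees (bigD1 i) //= ltr_pwDl //.
    by have [|/fi] := fP i.
  by apply: sumr_ge0 => j _; have [/ltW|/lev0 ->] := fP j.
- apply: odd_codimW (codim _ _ (fun i => inertia_le0 (ind i))) _ => f fP.
  by rewrite level_trees -oppr_ge0 -sumrN sumr_ge0 // => i _; rewrite oppr_ge0.
- rewrite -big_split; apply: odd_codimW (codim _ _ (fun i => inertia_lt0 (ind i))) _ => f fP.
  have [f0|/existsNP[i fi]] := pselect (forall i, restrict i f = 0).
    by right; apply/null_trees.
  left; rewrite level_trees -oppr_gt0 -sumrN (bigD1 i) //= ltr_pwDl // ?oppr_gt0.
    by have [|/fi] := fP i.
  by apply: sumr_ge0 => j _; rewrite oppr_ge0; have [/ltW|/lev0 ->] := fP j.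
- apply: odd_codimW (codim _ _ (fun i => inertia_eig0 (ind i))) _ => f fP.
  by move=> /eigen_trees ef; apply/null_trees => i; exact: fP.
- rewrite -big_split; apply: odd_codimW (codim _ _ (fun i => inertia_eig (ind i))) _ => f fP.
  exact/eigen_trees.
Qed.

End Forest.

Theorem theorem3p7 (R : realType) (V : finType) (G : wgraph R V)
    (kappa : V -> R) (p : R) (k : nat) (T : 'I_k -> {set V}) :
  1 < p ->
  forest_decomposition G T ->
  forall lambda : R, is_eigenvalue G kappa p lambda ->
    is_variational G kappa p lambda /\
    (variational_mult G kappa p lambda)%:R%:E = genus_mult G kappa p lambda /\
    variational_mult G kappa p lambda =
      (\sum_(i < k)
        if `[< is_eigenvalue (induced_subgraph G (T i))
                 (restrict_fun (A := T i) kappa) p lambda >]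
        then variational_mult (induced_subgraph G (T i))
               (restrict_fun (A := T i) kappa) p lambda
        else 0)%N.
Proof.
move=> p1 forest lambda eig.
have [_ _ trees] := forest.
have /choice[abz abzP] : forall i, exists abz : nat * nat * nat, _ :=
  fun i => graph_inertia (restrict_fun (A := T i) kappa) lambda p1 (trees i).2.
have ind := forest_inertia p1 forest (fun i => (abzP i).2).
have sz : (\sum_i (abz i).1.1 + \sum_i (abz i).1.2 + \sum_i (abz i).2)%N = #|V|.
  rewrite (card_trees forest) -!big_split /=.
  by apply: eq_bigr => i _; exact: (abzP i).1.
have z0 := (eigenvalue_inertia p1 sz ind).1 eig.
split.
  exists (\sum_i (abz i).1.1).+1; split; first by rewrite -sz; lia.
  by apply/eqP; rewrite (variational_value_eq p1 sz ind); lia.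
rewrite (variational_mult_inertia p1 sz ind) (genus_mult_inertia p1 sz ind).
split=> //; apply: eq_bigr => i _; case: asboolP => ei.
  by rewrite (variational_mult_inertia p1 (abzP i).1 (abzP i).2).
apply/eqP; rewrite -leqn0 leqNgt; apply/negP => zi; apply: ei.
exact/(eigenvalue_inertia p1 (abzP i).1 (abzP i).2).
Qed.
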